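(* Let $L,\varphi,\sigma_0,m_L,\psi,r_0,K_r,K_r^\sharp$ be as in the context. There exists a positive function $r\mapsto\theta(\psi,r)$, defined and nonincreasing on $[r_0,1)$ (depending only on $\psi$ and $r$), such that for every $w\in L^2_*\big((0,1),\tfrac{dt}{t^{1-2\sigma_0}}\big)$ and every $r\in[r_0,1)$, $$\mathrm{dist}(w,K_r^\sharp)\le\big(1+\theta(\psi,r)\sqrt{1-r}\big)\,\mathrm{dist}(w,K_r),$$ where distances are taken in $L^2\big((0,+\infty),\tfrac{dt}{t^{1-2\sigma_0}}\big)$. Furthermore $\lim_{r\to1}\theta(\psi,r)\sqrt{1-r}=0$.
   Context: For $r\in\mathbb R$ let $\Pi_r=\{s\in\mathbb C:\Re(s)>r\}$. Fix a Dirichlet series $L(s)=\sum_{n\ge1}a_nn^{-s}$ such that: $a_n=O_\varepsilon(n^\varepsilon)$ for every $\varepsilon>0$; there is $\sigma_0<1$ such that $L$ has a meromorphic continuation to $\Pi_{\sigma_0}$ with a unique pole, of order $m_L\ge1$, at $s=1$; and $(s-1)^{m_L}L(s)$ is analytic of finite order in $\Pi_{\sigma_0}$ (i.e. $O(\exp(|s|^c))$ for some $c$). Fix a measurable $\varphi:[0,+\infty)\to\mathbb C$ supported on $[0,1]$, locally bounded on $(0,1)$, with $\varphi(x)=O(x^{-\sigma_0})$ as $x\to0$ and $\varphi(x)=O((1-x)^{-\sigma_1})$ as $x\to1^-$ for some $\sigma_1<1/2$. Its Mellin transform $\widehat\varphi(s)=\int_0^{+\infty}\varphi(t)t^{s-1}\,dt$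 is analytic on $\Pi_{\sigma_0}$. It is assumed that $L(s)\widehat\varphi(s)$ has a pole of order exactly $m_L$ at $s=1$ (i.e. $\widehat\varphi(1)\ne0$). For $u>0$ put $$\psi(u)=\mathrm{res}\big(L(s)\widehat\varphi(s)u^s,\,s=1\big)-\sum_{n<u}a_n\varphi(n/u).$$ Fix a real $r_0$ with $\sigma_0<r_0<1$ and $\int_1^{+\infty}|\psi(t)|^2\frac{dt}{t^{1+2r_0}}<+\infty$ (assumed to exist). Let $\mathcal S=\bigcup_{\ell\ge1}(0,1]^\ell\times\mathbb C^\ell$; for $A=(\alpha,c)\in\mathcal S$ with $\alpha=(\alpha_1,\dots,\alpha_\ell)$, $c=(c_1,\dots,c_\ell)$ write $\ell(A)=\ell$. Let $\mathcal S^\sharp$ be the set of $A\in\mathcal S$ with $\sum_{j=1}^{\ell(A)}c_j\alpha_j(\log\alpha_j)^k=0$ for all $0\le k\le m_L-1$. For $A\in\mathcal S$ and $r_0\le r<1$ let $f_{A,r}(t)=t^{r-\sigma_0}\sum_{j=1}^{\ell(A)}c_j\psi(\alpha_j/t)$ for $t>0$; this belongs to $L^2\big((0,+\infty),\tfrac{dt}{t^{1-2\sigma_0}}\big)$. $K_r$ (resp. $K_r^\sharp$) is the closed linear span in $L^2\big((0,+\infty),\tfrac{dt}{t^{1-2\sigma_0}}\big)$ of $\{f_{A,r}:A\in\mathcal S\}$ (resp. $\{f_{A,r}:A\in\mathcal S^\sharp\}$). $L^2_*\big((0,1),\tfrac{dt}{t^{1-2\sigma_0}}\big)$ is the subspace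 of functions of $L^2\big((0,+\infty),\tfrac{dt}{t^{1-2\sigma_0}}\big)$ vanishing almost everywhere on $(1,+\infty)$. *)

(* Defs.v *)
From HB Require Import structures.
From mathcomp Require Import all_boot all_order all_algebra.
From mathcomp Require Import complex.
From mathcomp Require Import all_classical all_reals all_analysis.

Set Implicit Arguments.
Unset Strict Implicit.
Unset Printing Implicit Defensive.

Import Order.TTheory GRing.Theory Num.Theory.
Import numFieldNormedType.Exports.
Local Open Scope classical_set_scope.
Local Open Scope ring_scope.

(* [R[i]^o] is [R[i]] seen as a topological (normed) space; the alias is only
   needed where limits or neighbourhoods are involved. *)
Notation cmod := ComplexField.Normc.normc.

Section complex_functions.
Variable R : realType.
Implicit Types (f g : R[i] -> R[i]) (a s : R[i]).

(* [cpow t s] is t^s for t > 0, extended by 0 to t <= 0. *)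
Definition cpow (t : R) (s : R[i]) : R[i] :=
  if 0 < t then
    real_complex R (expR (complex.Re s * ln t)) *
    Complex (cos (complex.Im s * ln t)) (sin (complex.Im s * ln t))
  else 0.

Definition half_plane (r : R) : set R[i] := [set s | r < complex.Re s].

Definition analytic_at f a : Prop :=
  exists c : nat -> R[i]^o,
    \forall s \near (a : R[i]^o),
      series (fun k => c k * (s - a) ^+ k) @ \oo --> (f s : R[i]^o).

Definition analytic_on (U : set R[i]) f : Prop :=
  forall s, U s -> analytic_at f s.

Definition has_pole f a (m : nat) : Prop :=
  exists g, [/\ analytic_at g a, g a != 0 &
    \forall s \near (a : R[i]^o)^', f s = g s / (s - a) ^+ m].

(* [b k] is the coefficient of (s - a)^-(k+1) in the principal part. *)
Definition is_residue f a (c : R[i]) : Prop :=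
  exists (N : nat) (b : nat -> R[i]) g,
    [/\ analytic_at g a, b 0%N = c &
      \forall s \near (a : R[i]^o)^',
        f s = g s + \sum_(k < N.+1) b k / (s - a) ^+ k.+1].

Definition residue f a : R[i] := xget 0 [set c | is_residue f a c].

Definition cmeasurable (D : set R) (h : R -> R[i]) : Prop :=
  measurable_fun D (fun t => complex.Re (h t)) /\
  measurable_fun D (fun t => complex.Im (h t)).

Definition cintegral (D : set R) (h : R -> R[i]) : R[i] :=
  Complex (\int[lebesgue_measure]_(t in D) complex.Re (h t))
          (\int[lebesgue_measure]_(t in D) complex.Im (h t)).

Definition mellin (phi : R -> R[i]) (s : R[i]) : R[i] :=
  cintegral `]0, +oo[ (fun t => phi t * cpow t (s - 1)).

End complex_functions.

Section hypotheses.
Variable R : realType.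

(* [L] stands for the meromorphic continuation of the Dirichlet series
   with coefficients [a n], n >= 1, to the half-plane Re s > sigma0; only its
   values there, away from the pole, matter. *)
Record dirichlet_hyp (a : nat -> R[i]) (L : R[i] -> R[i]) (sigma0 : R)
    (m : nat) : Prop := DirichletHyp {
  dirichlet_coef : forall eps : R, 0 < eps ->
    exists M : R, forall n : nat, (0 < n)%N -> cmod (a n) <= M * n%:R `^ eps ;
  dirichlet_sigma0 : sigma0 < 1 ;
  dirichlet_series : forall s : R[i], half_plane 1 s ->
    (fun N => \sum_(1 <= n < N) a n * cpow n%:R (- s)) @ \oo
      --> (L s : R[i]^o) ;
  dirichlet_analytic : analytic_on (half_plane sigma0 `\ 1) L ;
  dirichlet_order : (1 <= m)%N ;
  dirichlet_pole : has_pole L 1 m ;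
  dirichlet_finite_order : exists H : R[i] -> R[i],
    [/\ forall s, half_plane sigma0 s -> s != 1 -> H s = (s - 1) ^+ m * L s,
        analytic_on (half_plane sigma0) H &
        exists c M T : R, forall s, half_plane sigma0 s -> T <= cmod s ->
          cmod (H s) <= M * expR (cmod s `^ c)]
}.

(* Only the values of [phi] on [0, +oo[ matter. *)
Record phi_hyp (phi : R -> R[i]) (sigma0 : R) : Prop := PhiHyp {
  phi_measurable : cmeasurable `[0, +oo[ phi ;
  phi_support : forall x : R, 1 < x -> phi x = 0 ;
  phi_locally_bounded : forall x : R, 0 < x < 1 ->
    exists M : R, \forall y \near x, cmod (phi y) <= M ;
  phi_at_0 : exists M : R,
    \forall x \near (0 : R)^'+, cmod (phi x) <= M * x `^ (- sigma0) ;
  phi_at_1 : exists2 sigma1 : R, sigma1 < 2^-1 &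
    exists M : R,
      \forall x \near (1 : R)^'-, cmod (phi x) <= M * (1 - x) `^ (- sigma1)
}.

End hypotheses.

Section approximation_spaces.
Variable R : realType.

Definition psi (a : nat -> R[i]) (L : R[i] -> R[i]) (phi : R -> R[i])
    (u : R) : R[i] :=
  residue (fun s => L s * mellin phi s * cpow u s) 1 -
  \sum_(1 <= n < (Num.truncn u).+1 | n%:R < u) a n * phi (n%:R / u).

(* Norm and membership in L^2(]0, +oo[, dt / t^(1 - 2 sigma0)); functions are
   not quotiented by almost everywhere equality. *)
Definition l2norm (sigma0 : R) (f : R -> R[i]) : \bar R :=
  poweR (\int[lebesgue_measure]_(t in `]0%R, +oo[)
           (cmod (f t) ^+ 2 / t `^ (1 - 2 * sigma0))%:E)%E 2^-1.

Definition L2 (sigma0 : R) : set (R -> R[i]) :=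
  [set f | cmeasurable `]0, +oo[ f /\ (l2norm sigma0 f < +oo)%E].

Definition L2star (sigma0 : R) : set (R -> R[i]) :=
  [set f | L2 sigma0 f /\ {ae lebesgue_measure, forall t : R, 1 < t -> f t = 0}].

Definition linear_span (E : set (R -> R[i])) : set (R -> R[i]) :=
  [set h | exists (n : nat) (c : 'I_n -> R[i]) (f : 'I_n -> R -> R[i]),
    (forall i, E (f i)) /\ h = (fun t => \sum_(i < n) c i * f i t)].

Definition closed_span (sigma0 : R) (E : set (R -> R[i])) : set (R -> R[i]) :=
  [set g | L2 sigma0 g /\ forall eps : R, 0 < eps ->
    exists2 h, linear_span E h &
      (l2norm sigma0 (fun t => (g t - h t)%R) < eps%:E)%E].

Definition dist (sigma0 : R) (w : R -> R[i]) (K : set (R -> R[i])) : \bar R :=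
  ereal_inf [set l2norm sigma0 (fun t => w t - g t) | g in K].

Record multiplet := Multiplet {
  ell : nat ;
  alpha : 'I_ell -> R ;
  coef : 'I_ell -> R[i]
}.

Definition calS : set multiplet :=
  [set A | (1 <= ell A)%N /\ forall j : 'I_(ell A), 0 < alpha j <= 1].

Definition calS_sharp (m : nat) : set multiplet :=
  [set A | calS A /\ forall k : nat, (k <= m.-1)%N ->
    \sum_(j < ell A) coef j * real_complex R (alpha j * ln (alpha j) ^+ k) = 0].

Definition fA (psi0 : R -> R[i]) (sigma0 r : R) (A : multiplet) (t : R) : R[i] :=
  real_complex R (t `^ (r - sigma0)) *
  \sum_(j < ell A) coef j * psi0 (alpha j / t).

Definition K (psi0 : R -> R[i]) (sigma0 r : R) : set (R -> R[i]) :=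
  closed_span sigma0 [set fA psi0 sigma0 r A | A in calS].

Definition K_sharp (psi0 : R -> R[i]) (sigma0 : R) (m : nat) (r : R) :
    set (R -> R[i]) :=
  closed_span sigma0 [set fA psi0 sigma0 r A | A in calS_sharp m].

End approximation_spaces.

(* Main.v *)
(* On ]0, 1] the Dirichlet sum in psi is empty, so psi(u) is the residue at 1 of
   L(s) mellin(phi)(s) u^s, that is u Q(ln u) with deg Q = m - 1. Hence for t > 1
   f_A(t) = t^(r - sigma0 - 1) p(ln t), where p is a polynomial of degree < m
   whose coefficients determine, through an invertible triangular system, the
   moments sum_j c_j alpha_j (ln alpha_j)^k whose vanishing defines S^sharp.
   As the weight of p on ]1, +oo[ is t^(2 r - 3) dt, the coefficients of p are
   O(sqrt (1 - r)) times the norm of f_A there, which is at most ||w - f_A||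
   because w vanishes on ]1, +oo[. Subtracting from A a combination of m fixed
   dilates with the same moments gives an element of S^sharp and changes f_A on
   ]0, 1] by O(sqrt (1 - r)) ||w - f_A||, while on ]1, +oo[ the new function
   vanishes like w. *)
Require Import Defs.
From mathcomp Require Import all_boot all_order all_algebra.
From mathcomp Require Import complex.
From mathcomp Require Import all_classical all_reals all_analysis.
From HB Require Import structures.
From mathcomp Require Import measurable_realfun.
From mathcomp Require Import ring lra zify.

Set Implicit Arguments.
Unset Strict Implicit.
Unset Printing Implicit Defensive.

Import Order.TTheory GRing.Theory Num.Theory.
Import numFieldNormedType.Exports.
Local Open Scope classical_set_scope.
Local Open Scope ring_scope.

(** The function theta may depend on psi and r only, while L, phi, sigma0 and m vary. Two facts
    allow this. The values of psi on ]0, 1] determine Q, hence m, which is its size. And sigma0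
    cancels: |f_A(t)|^2 / t^(1 - 2 sigma0) equals t^(2 r - 1) |sum_j c_j psi(alpha_j / t)|^2. So
    theta(psi, r) is a constant attached to Q times [node_weight], built from the norms on ]0, 1] of
    the dilates at m fixed nodes. For t <= 1 these norms decrease as r grows, which gives the
    monotonicity; then theta(psi, r) <= theta(psi, r0), which gives the limit. The gain sqrt (1 - r)
    is a matter of scaling. Up to t = exp T with T = 1 / (1 - r), the weight t^(2 r - 3) is
    comparable to 1 / t, and x = ln t turns the mean square of p(ln t) into the one of p over
    [0, T]. Over that interval the k-th coefficient of p is O(T^(-k - 1/2)) times the quadratic
    norm, that is, O((1 - r)^k sqrt (1 - r)). An element of K need not be one of the f_A, but it is
    a limit of finite combinations of them, and each such combination is again a family of dilates,
    to which the correction applies. *)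

Section complex_modulus.
Variable R : realType.
Implicit Types (z w : R[i]) (t : R).
Local Notation "t %:C" := (real_complex R t).

Lemma normr_cmod z : `|z| = (cmod z)%:C.
Proof. by case: z => x y; rewrite normc_def. Qed.

Lemma cmod_ge0 z : 0 <= cmod z.
Proof. by case: z => x y; exact: sqrtr_ge0. Qed.

Lemma cmodD z w : cmod (z + w) <= cmod z + cmod w.
Proof. by have := ler_normD z w; rewrite !normr_cmod -rmorphD/= lecR. Qed.

Lemma cmodN z : cmod (- z) = cmod z.
Proof. by have := normrN z; rewrite !normr_cmod => -[]. Qed.

Lemma cmodB z w : cmod (z - w) = cmod (w - z).
Proof. by rewrite -opprB cmodN. Qed.

Lemma cmodBD z w : cmod (z - w) <= cmod z + cmod w.
Proof. by rewrite -(cmodN w) cmodD. Qed.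

Lemma cmodM z w : cmod (z * w) = cmod z * cmod w.
Proof. exact: ComplexField.Normc.normcM. Qed.

Lemma cmodV z : cmod z^-1 = (cmod z)^-1.
Proof. exact: ComplexField.Normc.normcV. Qed.

Lemma cmod0 : cmod (0 : R[i]) = 0.
Proof. exact: ComplexField.Normc.normc0. Qed.

Lemma cmod1 : cmod (1 : R[i]) = 1.
Proof. exact: ComplexField.Normc.normc1. Qed.

Lemma cmod_eq0 z : (cmod z == 0) = (z == 0).
Proof.
apply/idP/idP => [/eqP/ComplexField.Normc.eq0_normc->//|/eqP->].
by rewrite cmod0.
Qed.

Lemma cmodX z n : cmod (z ^+ n) = cmod z ^+ n.
Proof.
by elim: n => [|n IH]; rewrite ?expr0 ?cmod1// !exprS cmodM IH.
Qed.

Lemma cmod_real t : cmod t%:C = `|t|.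
Proof. by rewrite /= expr0n/= addr0 sqrtr_sqr. Qed.

Lemma cmod_nat n : cmod (n%:R : R[i]) = n%:R.
Proof. by rewrite -(rmorph_nat (real_complex R)) cmod_real ger0_norm. Qed.

Lemma cmod_sum (I : Type) (s : seq I) (P : pred I) (F : I -> R[i]) :
  cmod (\sum_(i <- s | P i) F i) <= \sum_(i <- s | P i) cmod (F i).
Proof.
elim/big_ind2 : _ => //; first by rewrite cmod0.
by move=> a b c d ab cd; rewrite (le_trans (cmodD _ _))// lerD.
Qed.

Lemma cmod_le_ReIm z : cmod z <= `|complex.Re z| + `|complex.Im z|.
Proof.
case: z => x y /=.
rewrite -[leRHS]ger0_norm ?addr_ge0// -sqrtr_sqr ler_wsqrtr//.
rewrite sqrrD !real_normK ?num_real// -[x ^+ 2 + _ + _]addrA lerD2l lerDr.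
by rewrite mulrn_wge0// mulr_ge0.
Qed.

Lemma cmod_sqr z : cmod z ^+ 2 = complex.Re z ^+ 2 + complex.Im z ^+ 2.
Proof. by case: z => x y /=; rewrite sqr_sqrtr// addr_ge0// sqr_ge0. Qed.

Lemma cvg_cmodP (u : nat -> R[i]) (l : R[i]) :
  (u @ \oo --> (l : R[i]^o)) <-> ((fun n => cmod (u n - l)) @ \oo --> (0 : R)).
Proof.
split => h; [apply/cvgrPdist_lt => e e0|
  apply: (iffRL (@cvgrPdist_lt _ (R[i]^o) _ \oo _ u l)) => e e0].
  have {}h := (@cvgrPdist_lt _ (R[i]^o) _ \oo _ u l).1 h.
  have : (0 : R[i]) < e%:C by rewrite ltcR.
  move=> /h; apply: filterS => n /=; rewrite normr_cmod ltcR sub0r normrN.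
  by rewrite ger0_norm ?cmod_ge0// cmodB.
have {}h (x : R) : 0 < x -> \forall n \near \oo, `|0 - cmod (u n - l)| < x.
  by move: x; apply/cvgrPdist_lt.
(* In the order of [R[i]], [0 < e] forces [e] to be real, so a real tolerance is enough. *)
case: e e0 => x y; rewrite ltcE/= => /andP[/eqP -> x0].
move: (h _ x0); apply: filterS => n /=.
rewrite normr_cmod ltcR sub0r normrN.
by rewrite ger0_norm ?cmod_ge0// cmodB.
Qed.

Lemma near_cmodP (a : R[i]) (P : R[i] -> Prop) :
  (\forall s \near (a : R[i]^o), P s) <->
  (exists2 rho : R, 0 < rho & forall s, cmod (s - a) < rho -> P s).
Proof.
split => [/nbhs_ballP[[x y] /= + h]|[rho rho0 h]].
  rewrite ltcE/= => /andP[/eqP y0 x0]; exists x => // s sa; apply: h.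
  by rewrite -ball_normE/= normr_cmod y0 ltcR cmodB.
apply/nbhs_ballP; exists rho%:C => /=; first by rewrite ltcR.
move=> s; rewrite -ball_normE/= normr_cmod ltcR cmodB; exact: h.
Qed.

Lemma dnear_cmodP (a : R[i]) (P : R[i] -> Prop) :
  (\forall s \near (a : R[i]^o)^', P s) <->
  (exists2 rho : R, 0 < rho &
     forall s, s != a -> cmod (s - a) < rho -> P s).
Proof.
split.
  rewrite /dnbhs /within /= => /near_cmodP[rho rho0 h].
  by exists rho => // s sa /h; apply.
move=> [rho rho0 h]; rewrite /dnbhs /within /=; apply/near_cmodP.
by exists rho => // s /h + sa; exact.
Qed.

End complex_modulus.

(** * Power series and residues *)

Section power_series.
Variable R : realType.
Implicit Types (p q c : nat -> R[i]) (z w : R[i]) (t : R).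
Local Notation "t %:C" := (real_complex R t).

Definition psum p (n : nat) : R[i] := \sum_(k < n) p k.

Definition conv p q (k : nat) : R[i] := \sum_(j < k.+1) p j * q (k - j)%N.

(** Convergence is read on the real sequence of moduli, where squeezing and limit arithmetic are
    available; [cvg_cmodP] identifies it with convergence in [R[i]^o]. *)
Definition ccvg (u : nat -> R[i]) (l : R[i]) : Prop :=
  (fun n => cmod (u n - l)) @ \oo --> (0 : R).

Lemma seriesE p : series p = psum p.
Proof. by apply/funext => n; rewrite /series/= big_mkord. Qed.

Lemma cvg_squeeze0 (u v : nat -> R) : (forall n, 0 <= u n <= v n) ->
  v @ \oo --> (0 : R) -> u @ \oo --> (0 : R).
Proof.
move=> uv v0; apply: (@squeeze_cvgr _ _ _ _ (fun=> 0) v) => //.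
- by apply: nearW => n; exact: uv.
- exact: cvg_cst.
Qed.

Lemma ccvg_unique u l l' : ccvg u l -> ccvg u l' -> l = l'.
Proof.
move=> ul ul'; apply/eqP; rewrite -subr_eq0 -cmod_eq0; apply/eqP.
have : (fun=> cmod (l - l')) @ \oo --> (0 : R).
  apply: (@cvg_squeeze0 _ (fun n => cmod (u n - l) + cmod (u n - l'))).
    move=> n; rewrite cmod_ge0/= (cmodB (u n)).
    rewrite (_ : l - l' = (l - u n) + (u n - l')); last by ring.
    exact: cmodD.
  rewrite -[X in _ --> X](addr0 (0 : R)); exact: cvgD.
move=> /cvg_lim <-//; by apply/esym; apply: lim_cst.
Qed.

Lemma ccvg_bounded u l : ccvg u l -> exists2 M, 0 < M & forall n, cmod (u n) <= M.
Proof.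
move=> ul.
have : bounded_fun (fun n => cmod (u n - l)).
  by apply: cvg_seq_bounded; apply/cvg_ex; exists 0.
move=> [M [Mr hM]]; exists (`|M| + 1 + cmod l).
  by rewrite ltr_wpDr ?cmod_ge0// ltr_wpDl.
move=> n; rewrite -(subrK l (u n)) (le_trans (cmodD _ _))// lerD2r.
have /= := hM (`|M| + 1) _ n I; rewrite (ger0_norm (cmod_ge0 _)); apply.
by rewrite (le_lt_trans (ler_norm _))// ltrDl.
Qed.

Lemma ccvgM u v l l' : ccvg u l -> ccvg v l' -> ccvg (fun n => u n * v n) (l * l').
Proof.
move=> ul vl.
have [M M0 hM] := ccvg_bounded vl.
apply: (@cvg_squeeze0 _ (fun n => M * cmod (u n - l) + cmod l * cmod (v n - l'))).
  move=> n; rewrite cmod_ge0/=.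
  rewrite (_ : _ - _ = (u n - l) * v n + l * (v n - l')); last by ring.
  rewrite (le_trans (cmodD _ _))// !cmodM lerD// mulrC ler_wpM2r ?cmod_ge0//.
rewrite [X in _ --> X](_ : 0 = M * 0 + cmod l * 0); last by rewrite !mulr0 addr0.
by apply: cvgD; apply: cvgMl_tmp.
Qed.

Lemma ccvg_cst l : ccvg (fun=> l) l.
Proof. by rewrite /ccvg subrr cmod0; exact: cvg_cst. Qed.

Lemma ccvgD u v l l' : ccvg u l -> ccvg v l' -> ccvg (fun n => u n + v n) (l + l').
Proof.
move=> ul vl.
apply: (@cvg_squeeze0 _ (fun n => cmod (u n - l) + cmod (v n - l'))).
  move=> n; rewrite cmod_ge0/=.
  by rewrite (_ : _ - _ = (u n - l) + (v n - l')) ?cmodD//; ring.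
by rewrite -[X in _ --> X](addr0 (0 : R)); apply: cvgD.
Qed.

Lemma ccvg_le u l M : ccvg u l -> (forall n, cmod (u n) <= M) -> cmod l <= M.
Proof.
move=> ul uM; apply/ler_addgt0Pr => e e0.
move/cvgrPdist_lt : ul => /(_ _ e0)[N _ /(_ N (leqnn _))/=].
rewrite sub0r normrN ger0_norm ?cmod_ge0// => h.
rewrite -(subrK (u N) l) (le_trans (cmodD _ _))// addrC lerD//.
by rewrite cmodB ltW.
Qed.

Lemma psum_term_bounded p l : ccvg (psum p) l ->
  exists2 M, 0 < M & forall n, cmod (p n) <= M.
Proof.
move=> /ccvg_bounded[M M0 hM]; exists (M + M); first exact: addr_gt0.
move=> n; rewrite (_ : p n = psum p n.+1 - psum p n).
  by rewrite (le_trans (cmodBD _ _))// lerD.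
by rewrite /psum big_ord_recr/= [X in _ = X - _]addrC addrK.
Qed.

(* The partial products differ from the partial sums of [conv p q] by terms of
   total degree at least n, which are at most 2 n^2 M^2 8^-n <= 2 M^2 2^-n. *)
Lemma cauchy_product p q M P Q :
  (forall k, cmod (p k) <= M * 8^-1 ^+ k) ->
  (forall k, cmod (q k) <= M * 8^-1 ^+ k) ->
  ccvg (psum p) P -> ccvg (psum q) Q -> ccvg (psum (conv p q)) (P * Q).
Proof.
move=> hp hq pP qQ.
have M0 : 0 <= M by have := hp 0%N; rewrite expr0 mulr1; exact: le_trans (cmod_ge0 _).
suff h : (fun n => cmod (psum (conv p q) n - psum p n * psum q n)) @ \oo --> (0 : R).
  have h0 : ccvg (fun n => psum (conv p q) n - psum p n * psum q n) 0.
    by rewrite /ccvg; under eq_fun do rewrite subr0.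
  have := ccvgD h0 (ccvgM pP qQ); rewrite add0r.
  by congr (ccvg _ _); apply/funext => n; rewrite subrK.
apply: (@cvg_squeeze0 _ (fun n => (2 * M ^+ 2) * 2^-1 ^+ n)); last first.
  rewrite -[X in _ --> X](mulr0 (2 * M ^+ 2)); apply: cvgMl_tmp.
  by apply: cvg_expr; rewrite ger0_norm// invf_lt1// ltr1n.
move=> n; rewrite cmod_ge0/=.
(* The truncated series are polynomials evaluated at 1: the first n coefficients of [A * B] are
   those of [conv p q], and the other n form the error. *)
pose A := \poly_(i < n) p i; pose B := \poly_(i < n) q i.
have sA : psum p n = A.[1].
  by rewrite horner_poly; apply: eq_bigr => i _; rewrite expr1n mulr1.
have sB : psum q n = B.[1].
  by rewrite horner_poly; apply: eq_bigr => i _; rewrite expr1n mulr1.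
have AB : (size (A * B)%R <= n + n)%N.
  rewrite (leq_trans (size_polyMleq _ _))// (leq_trans (leq_pred _))//.
  by rewrite leq_add// size_poly.
rewrite sA sB -hornerM (horner_coef_wide _ AB) big_split_ord/=.
have -> : psum (conv p q) n = \sum_(i < n) (A * B)`_i * 1 ^+ i.
  apply: eq_bigr => i _; rewrite expr1n mulr1 coefM; apply: eq_bigr => j _.
  have jn : (j < n)%N by rewrite (leq_ltn_trans _ (ltn_ord i))// -ltnS.
  rewrite !coef_poly jn ifT//.
  by rewrite (leq_ltn_trans (leq_subr _ _)).
rewrite opprD addrA subrr add0r cmodN (le_trans (cmod_sum _ _ _))//.
have hc k : cmod (A * B)`_k <= k.+1%:R * M ^+ 2 * 8^-1 ^+ k.
  rewrite coefM (le_trans (cmod_sum _ _ _))//.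
  rewrite -mulrA mulr_natl -[in leRHS](card_ord k.+1) -sumr_const.
  apply: ler_sum => j _; rewrite cmodM.
  have -> : M ^+ 2 * 8^-1 ^+ k = (M * 8^-1 ^+ j) * (M * 8^-1 ^+ (k - j)).
    by rewrite mulrACA -exprD subnKC// -ltnS.
  apply: ler_pM; rewrite ?cmod_ge0// coef_poly; case: ifP => // _;
    by rewrite cmod0 mulr_ge0// exprn_ge0.
have -> : 2 * M ^+ 2 * 2^-1 ^+ n = (4 ^+ n * 8^-1 ^+ n) * (2 * M ^+ 2).
  by rewrite -exprMn mulrC; congr (_ ^+ _ * _); lra.
apply: (@le_trans _ _ (\sum_(i < n) (n%:R + n%:R) * M ^+ 2 * 8^-1 ^+ n)).
  apply: ler_sum => i _; rewrite expr1n mulr1 (le_trans (hc _))//.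
  apply: ler_pM => //.
  - by rewrite mulr_ge0// sqr_ge0.
  - rewrite ler_wpM2r ?sqr_ge0// -natrD ler_nat -addnS leq_add2l; exact: ltn_ord.
  - by rewrite ler_wiXn2l// ?invf_le1// ?ler1n// leq_addr.
rewrite sumr_const card_ord.
have n4 : (n%:R ^+ 2 : R) <= 4 ^+ n.
  rewrite (_ : 4 = 2 ^+ 2 :> R); last by rewrite -natrX.
  rewrite exprAC ler_pXn2r ?nnegrE ?exprn_ge0//.
  by rewrite -natrX ler_nat ltnW// ltn_expl.
have -> : (n%:R + n%:R) * M ^+ 2 * 8^-1 ^+ n *+ n =
          (n%:R ^+ 2 * 8^-1 ^+ n) * (2 * M ^+ 2) :> R by rewrite -mulr_natl; ring.
by rewrite ler_wpM2r ?mulr_ge0 ?sqr_ge0// ler_wpM2r// exprn_ge0.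
Qed.

Lemma psum_pow0 c n : psum (fun k => c k * 0 ^+ k) n.+1 = c 0%N.
Proof.
rewrite /psum big_ord_recl expr0 mulr1 big1 ?addr0// => i _.
by rewrite expr0n/= mulr0.
Qed.

Lemma analytic_atP (f : R[i] -> R[i]) a : analytic_at f a <->
  exists c, exists2 rho, 0 < rho & forall z, cmod z < rho ->
    ccvg (psum (fun k => c k * z ^+ k)) (f (a + z)).
Proof.
split => [[c /near_cmodP[rho rho0 h]]|[c [rho rho0 h]]].
  exists c; exists rho => // z zr.
  have := h (a + z); rewrite [a + z]addrC addrK => /(_ zr) /cvg_cmodP.
  by rewrite seriesE.
exists c; apply/near_cmodP; exists rho => // s sr.
apply/cvg_cmodP; rewrite seriesE.
by have := h _ sr; rewrite [a + _]addrC subrK.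
Qed.

(** Convergence at [rho] bounds the terms there; in a disc 8 times smaller they decay like 8^-k, the
    rate that [cauchy_product] asks for. *)
Lemma pow_term_bound c rho l : 0 < rho ->
  ccvg (psum (fun k => c k * rho%:C ^+ k)) l ->
  exists2 M, 0 < M &
    forall z, cmod z <= rho / 8 -> forall k, cmod (c k * z ^+ k) <= M * 8^-1 ^+ k.
Proof.
move=> rho0 /psum_term_bounded[M M0 hM]; exists M => // z zr k.
have := hM k; rewrite !cmodM !cmodX cmod_real (ger0_norm (ltW rho0)) => h.
rewrite (le_trans _ (ler_wpM2r _ h)) ?exprn_ge0// -mulrA ler_wpM2l ?cmod_ge0//.
by rewrite -exprMn lerXn2r ?nnegrE ?cmod_ge0// mulr_ge0// ltW.
Qed.

End power_series.

(** * The exponential series and the Taylor expansion of u^s at 1 *)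

Section complex_exponential.
Variable R : realType.
Implicit Types (x y : R) (z : R[i]).
Local Notation "t %:C" := (real_complex R t).

Definition cexp_coef z (k : nat) : R[i] := z ^+ k / k`!%:R.

Lemma natC n : (n%:R : R[i]) = n%:R%:C.
Proof. by rewrite rmorph_nat. Qed.

Lemma cmod_cexp_coef z k : cmod (cexp_coef z k) = exp_coeff (cmod z) k.
Proof. by rewrite cmodM cmodV cmodX cmod_nat. Qed.

(** After multiplication by 8^k the left side is one term of the exponential series at 8 |z|, hence
    at most its sum. *)
Lemma cexp_coef_bound z k :
  cmod (cexp_coef z k) <= expR (8 * cmod z) * 8^-1 ^+ k.
Proof.
rewrite cmod_cexp_coef /exp_coeff/= exprVn ler_pdivlMr ?exprn_gt0//.
have -> : cmod z ^+ k / k`!%:R * 8 ^+ k = exp_coeff (8 * cmod z) k.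
  by rewrite /exp_coeff/= exprMn; ring.
have h0 n : 0 <= exp_coeff (8 * cmod z) n.
  by rewrite exp_coeff_ge0// mulr_ge0// cmod_ge0.
apply: (@le_trans _ _ (series (exp_coeff (8 * cmod z)) k.+1)).
  by rewrite /series/= big_nat_recr//= lerDr sumr_ge0.
apply: nondecreasing_cvgn_le; last exact: is_cvg_series_exp_coeff.
apply/nondecreasing_seqP => n.
by rewrite /series/= big_nat_recr//= lerDl.
Qed.

Lemma psum_ReIm (p : nat -> R[i]) n : psum p n =
  Complex (series (fun k => complex.Re (p k)) n)
          (series (fun k => complex.Im (p k)) n).
Proof.
rewrite /psum /series/= !big_mkord.
elim/big_ind3 : _ => //; last by move=> i _; case: (p i).
by move=> x1 x2 [? ?] y1 y2 [? ?] -> ->.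
Qed.

Lemma ccvg_ReIm (u : nat -> R[i]) (x y : R) :
  (fun n => complex.Re (u n)) @ \oo --> x ->
  (fun n => complex.Im (u n)) @ \oo --> y -> ccvg u (Complex x y).
Proof.
move=> ux uy.
apply: (@cvg_squeeze0 _ _ (fun n => `|complex.Re (u n) - x| + `|complex.Im (u n) - y|)).
  move=> n; rewrite cmod_ge0/= (le_trans (cmod_le_ReIm _))//.
  by case: (u n).
rewrite -[X in _ --> X](addr0 (0 : R)); apply: cvgD.
  by apply/norm_cvg0P; rewrite -(subrr x); apply: cvgB => //; exact: cvg_cst.
by apply/norm_cvg0P; rewrite -(subrr y); apply: cvgB => //; exact: cvg_cst.
Qed.

Lemma cexp_real x : ccvg (psum (cexp_coef x%:C)) (expR x)%:C.
Proof.
have E k : cexp_coef x%:C k = (exp_coeff x k)%:C.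
  by rewrite /cexp_coef /exp_coeff natC -rmorphXn -rmorphV ?unitfE ?pnatr_eq0 -?lt0n ?fact_gt0// -rmorphM.
apply: ccvg_ReIm.
  under eq_fun do rewrite psum_ReIm/=.
  rewrite (_ : (fun k => complex.Re (cexp_coef x%:C k)) = exp_coeff x); last first.
    by apply/funext => k; rewrite E.
  exact: is_cvg_series_exp_coeff.
under eq_fun do rewrite psum_ReIm/=.
rewrite (_ : series _ = fun=> 0); first exact: cvg_cst.
by apply/funext => n; rewrite /series/= big1// => i _; rewrite E.
Qed.

Lemma cexp_imag y : ccvg (psum (cexp_coef (Complex 0 y))) (Complex (cos y) (sin y)).
Proof.
(* Even powers of iy are real and odd ones imaginary, which matches the parity tests in [cos_coeff]
   and [sin_coeff]. *)
have iX k : (Complex 0 y) ^+ k.*2 = ((-1) ^+ k * y ^+ k.*2)%:C.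
  rewrite -mul2n exprM exprM -exprMn rmorphXn/=; congr (_ ^+ _).
  by rewrite !expr2; apply/eqP; rewrite eq_complex/=; apply/andP; split; apply/eqP; ring.
have fE (a : R[i]) k : a / k`!%:R = Complex (complex.Re a / k`!%:R) (complex.Im a / k`!%:R).
  rewrite natC -fmorphV; case: a => a b.
  by apply/eqP; rewrite eq_complex/=; apply/andP; split; apply/eqP; ring.
have parity k : exists j, k = j.*2 \/ k = j.*2.+1.
  exists k./2; have := odd_double_half k.
  by case: odd => /= E; [right|left]; rewrite -[LHS]E.
apply: ccvg_ReIm; under eq_fun do rewrite psum_ReIm/=.
  rewrite (_ : (fun k => complex.Re (cexp_coef (Complex 0 y) k)) = cos_coeff y).
    by rewrite unlock; exact: is_cvg_series_cos_coeff.
  apply/funext => k; rewrite /cexp_coef fE/= /cos_coeff/=; congr (_ / _).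
  have [j [->|->]] := parity k; rewrite ?exprS iX /= odd_double/=.
    by rewrite doubleK mul1r.
  by rewrite !mul0r mulr0 subr0.
rewrite (_ : (fun k => complex.Im (cexp_coef (Complex 0 y) k)) = sin_coeff y).
  by rewrite unlock; exact: is_cvg_series_sin_coeff.
apply/funext => k; rewrite /cexp_coef fE/= /sin_coeff/=; congr (_ / _).
have [j [->|->]] := parity k; rewrite ?exprS iX /= odd_double/=.
  by rewrite !mul0r.
by rewrite doubleK mul1r mul0r add0r mulrCA.
Qed.

(** This is the binomial theorem divided by k!. *)
Lemma conv_cexp z w k : conv (cexp_coef z) (cexp_coef w) k = cexp_coef (z + w) k.
Proof.
rewrite /cexp_coef addrC exprDn mulr_suml; apply: eq_bigr => j _.
have jk : (j <= k)%N by rewrite -ltnS.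
rewrite -[X in _ = X / _]mulr_natr.
have := bin_fact jk => /(congr1 (fun n => n%:R : R[i])); rewrite !natrM => E.
have f0 n : (n`!%:R : R[i]) != 0 by rewrite pnatr_eq0 -lt0n fact_gt0.
have := f0 k; rewrite -E => k0.
move: k0; rewrite !mulf_eq0 !negb_or => /andP[k0 _].
by field; rewrite ?f0 ?k0.
Qed.

Lemma cexp_cvg z : ccvg (psum (cexp_coef z))
  ((expR (complex.Re z))%:C * Complex (cos (complex.Im z)) (sin (complex.Im z))).
Proof.
have -> : psum (cexp_coef z) =
   psum (conv (cexp_coef (complex.Re z)%:C) (cexp_coef (Complex 0 (complex.Im z)))).
  congr psum; apply/funext => k; rewrite conv_cexp; congr cexp_coef.
  by case: z => x y; apply/eqP; rewrite eq_complex/= addr0 add0r !eqxx.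
pose M := Num.max (expR (8 * cmod (complex.Re z)%:C))
                  (expR (8 * cmod (Complex 0 (complex.Im z)))).
apply: (@cauchy_product _ _ _ M).
- move=> k; rewrite (le_trans (cexp_coef_bound _ _))// ler_wpM2r ?exprn_ge0//.
  by rewrite le_max lexx.
- move=> k; rewrite (le_trans (cexp_coef_bound _ _))// ler_wpM2r ?exprn_ge0//.
  by rewrite le_max lexx orbT.
- exact: cexp_real.
- exact: cexp_imag.
Qed.

(** The coefficients come from u^(1 + z) = u exp (z ln u). *)
Lemma cpow_cvg (u : R) z : 0 < u ->
  ccvg (psum (fun k => (u * ln u ^+ k / k`!%:R)%:C * z ^+ k)) (cpow u (1 + z)).
Proof.
move=> u0; have := ccvgM (ccvg_cst u%:C) (cexp_cvg (z * (ln u)%:C)).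
have -> : cpow u (1 + z) = u%:C * ((expR (complex.Re (z * (ln u)%:C)))%:C *
   Complex (cos (complex.Im (z * (ln u)%:C))) (sin (complex.Im (z * (ln u)%:C)))).
  rewrite /cpow u0 mulrA -rmorphM/=; case: z => x y /=.
  rewrite !mulr0 subr0 add0r mulrDl mul1r expRD lnK ?posrE// add0r.
  by [].
congr (ccvg _ _); apply/funext => n; rewrite /psum mulr_sumr; apply: eq_bigr => k _.
rewrite /cexp_coef exprMn natC -fmorphV -!rmorphXn !rmorphM !rmorphXn/= mulrA.
ring.
Qed.

End complex_exponential.

(** * Uniqueness of the residue, and its value for F(s) u^s *)

Section residues.
Variable R : realType.
Implicit Types (F f g : R[i] -> R[i]) (a z : R[i]).
Local Notation "t %:C" := (real_complex R t).

Lemma analytic_bounded g a : analytic_at g a ->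
  exists2 rho, 0 < rho & exists2 M, 0 < M &
    forall z, cmod z < rho -> cmod (g (a + z)) <= M.
Proof.
move=> /analytic_atP[c [rho rho0 h]].
have hr2 : cmod (rho / 2)%:C < rho.
  by rewrite cmod_real ger0_norm ?ltr_pdivrMr ?mulr_ge0 ?ltW// ltr_pMr// ltr1n.
have [M M0 hM] := pow_term_bound (divr_gt0 rho0 (ltr0n _ 2)) (h _ hr2).
exists (rho / 2 / 8); first by rewrite !divr_gt0.
exists (M * 2); first by rewrite mulr_gt0.
move=> z zr; apply: (ccvg_le (h _ _)).
  rewrite (lt_le_trans zr)// ler_pdivrMr// ler_pdivrMr// -mulrA.
  by rewrite ler_peMr ?(ltW rho0)// -natrM ler1n.
move=> n; rewrite (le_trans (cmod_sum _ _ _))//.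
(* With ratio 1/2 the bound 2 reproduces itself by induction, since 1 + 2 / 2 = 2. *)
apply: (@le_trans _ _ (\sum_(k < n) M * 2^-1 ^+ k)).
  apply: ler_sum => k _; rewrite (le_trans (hM _ (ltW zr) _))// ler_pM2l//.
  by rewrite lerXn2r ?nnegrE// lef_pV2 ?posrE// ler_nat.
rewrite -mulr_sumr ler_pM2l//.
elim: n => [|n IH]; first by rewrite big_ord0.
rewrite big_ord_recl expr0.
rewrite (eq_bigr (fun i : 'I_n => 2^-1 * 2^-1 ^+ i)) => [|i _]; last first.
  by rewrite -exprS.
by rewrite -mulr_sumr; lra.
Qed.

(** The constant coefficient is a limit of quantities O(t), hence 0; dividing by X lowers by one
    both the size and the order of vanishing. Applied to a difference of principal parts, this makes
    the residue unique. *)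
Lemma poly_small_eq0 n (B : {poly R[i]}) rho M : (size B <= n)%N -> 0 < rho ->
  (forall t : R, 0 < t < rho -> cmod B.[t%:C] <= M * t ^+ n) -> B = 0.
Proof.
move=> + rho0; elim: n B => [|n IH] B sB h.
  by apply/eqP; rewrite -size_poly_eq0 -leqn0.
pose M' := M + \sum_(k < n) cmod B`_k.+1.
have B0 : B`_0 = 0.
  apply/eqP; rewrite -cmod_eq0 eq_le cmod_ge0 andbT.
  have M'p : 0 < `|M'| + 1 by rewrite ltr_wpDl.
  apply/ler_addgt0Pr => e e0; rewrite add0r.
  (* For t <= 1 the constant coefficient is at most t M', and the last term of the minimum makes
     this at most e. *)
  pose t := Num.min (rho / 2) (Num.min 1 (e / (`|M'| + 1))).
  have t0 : 0 < t by rewrite !lt_min !divr_gt0//= ltr01.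
  have tr : t < rho.
    rewrite (@le_lt_trans _ _ (rho / 2))//; first by rewrite ge_min lexx.
    by rewrite ltr_pdivrMr// ltr_pMr// ltr1n.
  have t1 : t <= 1 by rewrite !ge_min lexx orbT.
  have te : t * (`|M'| + 1) <= e.
    by rewrite -ler_pdivlMr// !ge_min lexx !orbT.
  apply: le_trans te.
  have -> : B`_0 = B.[t%:C] - \sum_(k < n) B`_k.+1 * t%:C ^+ k.+1.
    rewrite (horner_coef_wide _ sB) big_ord_recl expr0 mulr1.
    by rewrite [X in _ = _ + X - _](_ : _ = \sum_(k < n) B`_k.+1 * t%:C ^+ k.+1) ?addrK.
  rewrite (le_trans (cmodBD _ _))//.
  apply: (@le_trans _ _ (t * M')); last first.
    by rewrite ler_pM2l// (le_trans (ler_norm _))// lerDl.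
  rewrite /M' mulrDr lerD//.
    rewrite (le_trans (h _ _)) ?t0//.
    have M0 : 0 <= M.
      have := h (rho / 2); rewrite divr_gt0//= ltr_pdivrMr// ltr_pMr// ltr1n => /(_ isT).
      move/(le_trans (cmod_ge0 _)); rewrite pmulr_lge0// exprn_gt0//.
      by rewrite divr_gt0.
    rewrite [leRHS]mulrC ler_wpM2l// exprS ler_piMr ?(ltW t0)// exprn_ile1 ?(ltW t0)//.
  rewrite (le_trans (cmod_sum _ _ _))// mulr_sumr; apply: ler_sum => k _.
  rewrite cmodM cmodX cmod_real ger0_norm ?(ltW t0)// mulrC ler_wpM2r ?cmod_ge0//.
  by rewrite exprS ler_piMr ?(ltW t0)// exprn_ile1 ?(ltW t0)//.
have /factor_theorem[C BC] : root B 0 by rewrite /root horner_coef0 B0.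
rewrite subr0 in BC.
rewrite BC (IH C) ?mul0r//.
  have [->|C0] := eqVneq C 0; first by rewrite size_poly0.
  by move: sB; rewrite BC size_mulX.
move=> t /andP[t0 tr]; have := h t; rewrite t0 tr BC hornerMX cmodM cmod_real.
rewrite gtr0_norm// exprSr mulrA => /(_ isT).
by rewrite ler_pM2r.
Qed.

(** Multiplication by (s - a)^n with n = N + N' + 1 turns both principal parts into polynomials of
    degree < n. Their difference is (s - a)^n times a function bounded near a, so [poly_small_eq0]
    applies; the two residues are the coefficients of degree n - 1. *)
Lemma is_residue_unique f a c c' : is_residue f a c -> is_residue f a c' -> c = c'.
Proof.
move=> [N [b [g [ag <- /dnear_cmodP[r1 r10 h1]]]]].
move=> [N' [b' [g' [ag' <- /dnear_cmodP[r2 r20 h2]]]]].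
have [r3 r30 [M3 M30 h3]] := analytic_bounded ag.
have [r4 r40 [M4 M40 h4]] := analytic_bounded ag'.
pose n := (N + N').+1.
pose B (b : nat -> R[i]) N : {poly R[i]} := \sum_(k < N.+1) (b k)%:P * 'X^(n - k.+1).
have sB b0 N0 : (size (B b0 N0) <= n)%N.
  apply: (leq_trans (size_sum _ _ _)); apply/bigmax_leqP => k _.
  rewrite mul_polyC (leq_trans (size_scale_leq _ _))// size_polyXn.
  rewrite /n; lia.
have Bc b0 N0 : (N0 <= N + N')%N -> (B b0 N0)`_n.-1 = b0 0%N.
  move=> NN.
  rewrite coef_sum big_ord_recl big1 ?addr0.
    by rewrite coefCM coefXn subn1 eqxx mulr1.
  move=> i _; rewrite coefCM coefXn /= /n subSS.
  rewrite (_ : (_ == _) = false) ?mulr0//; apply/negbTE/eqP.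
  by case: i => i /= hi; rewrite /bump/=; lia.
have Bh b0 N0 z : (N0 <= N + N')%N -> z != 0 ->
    (B b0 N0).[z] = z ^+ n * \sum_(k < N0.+1) b0 k / z ^+ k.+1.
  move=> NN z0; rewrite horner_sum mulr_sumr; apply: eq_bigr => k _.
  rewrite hornerM hornerC hornerXn mulrCA; congr (_ * _).
  rewrite -[in RHS](@subnK k.+1 n) ?exprD ?mulfK ?expf_neq0//.
  by rewrite /n ltnS (leq_trans _ NN)// -ltnS.
suff E : B b N - B b' N' = 0.
  by have /subr0_eq := E; move/(congr1 (fun p : {poly R[i]} => p`_n.-1)); rewrite !Bc ?leq_addr ?leq_addl.
pose rho := Num.min (Num.min r1 r2) (Num.min r3 r4).
apply: (@poly_small_eq0 n _ rho (M3 + M4)).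
- by rewrite (leq_trans (size_polyD _ _))// size_polyN geq_max !sB.
- by rewrite !lt_min r10 r20 r30 r40.
move=> t /andP[t0]; rewrite !lt_min => /andP[/andP[t1 t2] /andP[t3 t4]].
have tC0 : t%:C != 0 by rewrite -cmod_eq0 cmod_real normr_eq0 gt_eqF.
have tC : cmod t%:C = t by rewrite cmod_real gtr0_norm.
have at0 : a + t%:C != a by rewrite addrC -subr_eq0 addrK.
have := h1 _ at0; have := h2 _ at0; rewrite [a + _ - a]addrAC subrr add0r tC.
move=> /(_ t2) E2 /(_ t1) E1.
rewrite hornerD hornerN !Bh ?leq_addr ?leq_addl// -mulrBr.
have -> : \sum_(k < N.+1) b k / t%:C ^+ k.+1 - \sum_(k < N'.+1) b' k / t%:C ^+ k.+1 =
    g' (a + t%:C) - g (a + t%:C).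
  by rewrite -[X in X - _](addKr (g (a + t%:C))) -E1 E2; ring.
rewrite cmodM cmodX tC mulrC ler_pM2r ?exprn_gt0//.
rewrite (le_trans (cmodBD _ _))// addrC lerD//; [apply: h3|apply: h4]; by rewrite tC.
Qed.

Lemma residue_eq f a c : is_residue f a c -> residue f a = c.
Proof.
move=> fc; apply: (@is_residue_unique f a) => //.
by rewrite /residue; case: xgetP => [y _ //|/(_ c)].
Qed.

(* Near 1, F(s) u^s = (s - 1)^-m sum_k d_k (s - 1)^k, where d is the Cauchy
   product of the Taylor coefficients of (s - 1)^m F(s) and of u^s; the residue
   is d_(m-1). *)
Lemma residue_pole_cpow F m : has_pole F 1 m -> (0 < m)%N ->
  exists2 Q : {poly R[i]}, size Q = m &
    forall u : R, 0 < u ->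
      residue (fun s => F s * cpow u s) 1 = u%:C * Q.[(ln u)%:C].
Proof.
move=> [G [aG G1 /dnear_cmodP[r1 r10 FG]]] m0.
have /analytic_atP[c [rho rho0 hG]] := aG.
have c0 : c 0%N = G 1.
  have h0 := hG 0; rewrite cmod0 addr0 in h0.
  apply: (ccvg_unique _ (h0 rho0)).
  rewrite /ccvg -cvg_shiftS/=; under eq_fun do rewrite psum_pow0.
  exact: ccvg_cst.
(* The coefficient d_(m-1) is the sum of c_(m-1-i) u (ln u)^i / i!. The leading coefficient of [Q]
   is G(1) / (m - 1)!, nonzero because the pole has order exactly m. *)
pose Q : {poly R[i]} := \poly_(i < m) (c (m.-1 - i)%N / i`!%:R).
have f0 n : (n`!%:R : R[i]) != 0 by rewrite pnatr_eq0 -lt0n fact_gt0.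
exists Q.
  rewrite size_poly_eq// subnn c0 mulf_neq0// invr_eq0//.
move=> u u0; apply: residue_eq.
pose e k : R[i] := (u * ln u ^+ k / k`!%:R)%:C.
pose d := conv c e.
have [r2 r20 hd] : exists2 r2, 0 < r2 & forall z, cmod z < r2 ->
    ccvg (psum (fun k => d k * z ^+ k)) (G (1 + z) * cpow u (1 + z)).
  have hr2 : cmod (rho / 2)%:C < rho.
    by rewrite cmod_real ger0_norm ?ltr_pdivrMr ?mulr_ge0 ?ltW// ltr_pMr// ltr1n.
  have [M1 M10 hM1] := pow_term_bound (divr_gt0 rho0 (ltr0n _ 2)) (hG _ hr2).
  have [M2 M20 hM2] := pow_term_bound (divr_gt0 rho0 (ltr0n _ 2)) (cpow_cvg (rho / 2)%:C u0).
  exists (rho / 2 / 8); first by rewrite !divr_gt0.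
  move=> z zr.
  have -> : (fun k => d k * z ^+ k) = conv (fun k => c k * z ^+ k) (fun k => e k * z ^+ k).
    apply/funext => k; rewrite /d /conv mulr_suml; apply: eq_bigr => j _.
    by rewrite mulrACA -exprD subnKC// -ltnS.
  apply: (@cauchy_product _ _ _ (Num.max M1 M2)).
  - move=> k; rewrite (le_trans (hM1 _ (ltW zr) _))// ler_wpM2r ?exprn_ge0//.
    by rewrite le_max lexx.
  - move=> k; rewrite (le_trans (hM2 _ (ltW zr) _))// ler_wpM2r ?exprn_ge0//.
    by rewrite le_max lexx orbT.
  - apply: hG; rewrite (lt_le_trans zr)// ler_pdivrMr// ler_pdivrMr// -mulrA.
    by rewrite ler_peMr ?(ltW rho0)// -natrM ler1n.
  - exact: cpow_cvg.
pose P z := \sum_(k < m) d k * z ^+ k.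
(* The regular part is the series sum_k d_(k+m) (s - 1)^k; its value at 1 has to be put in by hand,
   as the quotient there is a division by 0. *)
pose g s := if s == 1 then d m
            else (G s * cpow u s - P (s - 1)) / (s - 1) ^+ m.
exists m.-1, (fun k => d (m.-1 - k)%N), g; split.
- apply/analytic_atP; exists (fun k => d (k + m)%N); exists r2 => // z zr.
  have [->|z0] := eqVneq z 0.
    rewrite addr0 /g eqxx /ccvg -cvg_shiftS/=.
    under eq_fun do rewrite (psum_pow0 (fun k => d (k + m)%N)).
    exact: ccvg_cst.
  rewrite /g ifF; last first.
    by apply/negbTE; rewrite addrC -subr_eq0 addrK.
  rewrite [1 + z - 1]addrAC subrr add0r.
  have -> : psum (fun k => d (k + m)%N * z ^+ k) =
     fun n => (psum (fun k => d k * z ^+ k) (n + m)%N + - P z) * (z ^+ m)^-1.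
    apply/funext => n; rewrite /psum [(n + m)%N]addnC big_split_ord/=.
    rewrite [\sum_(i < m) _](_ : _ = P z)// [P z + _]addrC addrK mulr_suml.
    apply: eq_bigr => i _.
    by rewrite addnC exprD [z ^+ m * _]mulrC mulrA mulfK// expf_neq0.
  apply: ccvgM; last exact: ccvg_cst.
  apply: ccvgD; last exact: ccvg_cst.
  by have := hd _ zr; rewrite /ccvg -(cvg_shiftn m).
- rewrite subn0 horner_poly mulr_sumr /d /conv prednK//.
  rewrite (reindex_inj rev_ord_inj)/=; apply: eq_bigr => i _.
  have im : (i <= m.-1)%N by rewrite -ltnS prednK.
  have -> : (m - i.+1 = m.-1 - i)%N by lia.
  rewrite subKn// /e natC !rmorphM !rmorphXn/= fmorphV.
  by ring.
- apply/dnear_cmodP; exists r1 => // s s1 sr; rewrite FG//.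
  have s10 : s - 1 != 0 by rewrite subr_eq0.
  rewrite /g (negbTE s1) prednK//.
  have -> : \sum_(k < m) d (m.-1 - k)%N / (s - 1) ^+ k.+1 = P (s - 1) / (s - 1) ^+ m.
    rewrite /P mulr_suml (reindex_inj rev_ord_inj)/=; apply: eq_bigr => k _.
    have km : (k <= m.-1)%N by rewrite -ltnS prednK.
    have -> : (m.-1 - (m - k.+1) = k)%N by lia.
    rewrite -mulrA; congr (_ * _).
    rewrite subnSK// -[X in _ = _ / _ ^+ X](@subnK k m) ?(ltnW (ltn_ord k))//.
    by rewrite exprD invfM mulrCA mulfV ?mulr1// expf_neq0.
  by rewrite mulrBl subrK mulrAC.
Qed.

End residues.

(** * Moments and polynomials *)

Section moment_matrices.
Variable R : realType.
Local Notation "t %:C" := (real_complex R t).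

(* If v H = 0, the polynomial sum_j v_j prod_(l != j) (X + l + 1) of degree
   less than m vanishes at 0, ..., m - 1; its values at -(j + 1) are nonzero
   multiples of the v_j. *)
Lemma hilbert_unitmx m :
  (\matrix_(i < m, j < m) ((i + j).+1%:R : R)^-1) \in unitmx.
Proof.
set H := \matrix_(i, j) _.
rewrite -row_free_unit -kermx_eq0; apply/rowV0P => v /sub_kermxP vH.
pose x (l : 'I_m) : R := - l.+1%:R.
pose N : {poly R} := \sum_j v 0 j *: \prod_(l | l != j) ('X - (x l)%:P).
have sN : (size N <= m)%N.
  apply: (leq_trans (size_sum _ _ _)); apply/bigmax_leqP => j _.
  rewrite (leq_trans (size_scale_leq _ _))// -big_filter size_prod_XsubC.
  rewrite size_filter -sum1_count sum1_card cardC1 card_ord prednK//.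
  by case: j => j /=; lia.
have hN y : N.[y] = \sum_j v 0 j * \prod_(l | l != j) (y - x l).
  rewrite horner_sum; apply: eq_bigr => j _; rewrite hornerZ horner_prod.
  by congr (_ * _); apply: eq_bigr => l _; rewrite hornerXsubC.
have N0 : N = 0.
  apply: (@roots_geq_poly_eq0 _ _ [seq (i%:R : R) | i <- iota 0 m]).
  - apply/allP => _ /mapP[i + ->]; rewrite mem_iota add0n => /andP[_ im].
    have := congr1 (fun w : 'rV_m => w 0 (Ordinal im)) vH.
    rewrite !mxE => E; rewrite rootE hN.
    have yx l : i%:R - x l = (l + i).+1%:R.
      by rewrite /x opprK -natrD addnS addnC.
    transitivity ((\prod_l (i%:R - x l)) * \sum_j v 0 j * H j (Ordinal im) == 0);
      last by rewrite E mulr0 eqxx.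
    rewrite mulr_sumr; congr (_ == _); apply: eq_bigr => j _.
    rewrite [in RHS](bigD1 j)//= [H j _]mxE/= yx mulrCA; congr (_ * _).
    by rewrite mulrAC divff ?mul1r// pnatr_eq0.
  - by rewrite map_inj_uniq ?iota_uniq// => a b /eqP; rewrite eqr_nat => /eqP.
  - by rewrite size_map size_iota.
apply/rowP => j; rewrite mxE; apply/eqP.
have := hN (x j); rewrite N0 horner0 (bigD1 j)//= [X in _ + X]big1 ?addr0.
  move/esym/eqP; rewrite mulf_eq0 => /orP[//|].
  rewrite prodf_seq_eq0 => /hasP[l _ /andP[lj]].
  rewrite /x subr_eq0 eqr_opp eqr_nat eqSS => /eqP/val_inj E.
  by rewrite E eqxx in lj.
by move=> i ij; rewrite (bigD1 j) 1?eq_sym//= subrr mul0r mulr0.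
Qed.

(** As 1 / (i + j + 1) is the integral of x^(i+j) over [0, 1], row k of [G] gives a polynomial whose
    integral against any p of degree < m is the k-th coefficient of p. *)
Lemma dual_moments m : exists G : 'M[R]_m, forall k j : 'I_m,
  \sum_(i < m) G k i * (i + j).+1%:R^-1 = (k == j)%:R.
Proof.
exists (invmx (\matrix_(i < m, j < m) ((i + j).+1%:R : R)^-1)) => k j.
have := mulVmx (hilbert_unitmx m) => /matrixP/(_ k j); rewrite !mxE => <-.
by apply: eq_bigr => i _; rewrite !mxE.
Qed.

(** Distinct points of ]0, 1] with integer logarithms, so that the Vandermonde determinant below is
    plainly nonzero. *)
Definition node (j : nat) : R := expR (- j%:R).

Lemma ln_node j : ln (node j) = - j%:R.
Proof. exact: expRK. Qed.

Lemma node_itv j : 0 < node j <= 1.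
Proof. by rewrite /node expR_gt0 expR_le1 oppr_le0 ler0n. Qed.

(** The moment matrix of the nodes is the Vandermonde matrix of their logarithms times a diagonal
    matrix with positive entries; [V] is its inverse. *)
Lemma node_moments m : exists V : 'M[R]_m, forall k l : 'I_m,
  \sum_(j < m) node j * ln (node j) ^+ k * V j l = (k == l)%:R.
Proof.
pose a : 'rV[R]_m := \row_j (- (j : nat)%:R).
pose W := Vandermonde m a *m diag_mx (\row_j node j).
have uW : W \in unitmx.
  rewrite unitmx_mul !unitmxE det_Vandermonde det_diag; apply/andP; split.
    rewrite unitfE; apply/prodf_neq0 => i _; apply/prodf_neq0 => j ij.
    by rewrite !mxE opprK addrC subr_eq0 eqr_nat ltn_eqF.
  rewrite unitfE; apply/prodf_neq0 => i _; rewrite mxE.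
  by rewrite gt_eqF// expR_gt0.
exists (invmx W) => k l.
have := mulmxV uW => /matrixP/(_ k l); rewrite !mxE => <-.
apply: eq_bigr => j _; congr (_ * _).
by rewrite [in RHS]/W mul_mx_diag !mxE ln_node mulrC.
Qed.

Variable Q : {poly R[i]}.
Let m := size Q.

(** With y = ln al, its value at ln t is Q(ln (al / t)). *)
Definition shifted (y : R) : {poly R[i]} := Q \Po (y%:C%:P - 'X).

Lemma size_shifted y : (size (shifted y) <= m)%N.
Proof.
by rewrite /shifted size_comp_poly2// -size_polyN opprB size_XsubC.
Qed.

(** Entry (i, k) is the coefficient of X^i y^k in Q(y - X), by Taylor's formula at y. *)
Definition taylor_mx : 'M[R[i]]_m :=
  \matrix_(i, k) ((-1) ^+ i * (Q`_(i + k) *+ 'C(i + k, i))).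

Lemma coef_shifted y (i : 'I_m) :
  (shifted y)`_i = \sum_(k < m) taylor_mx i k * y%:C ^+ k.
Proof.
rewrite /shifted /comp_poly nderiv_taylor; last exact: mulrC.
rewrite size_map_polyC.
have -> : \sum_(j < size Q) (Q^:P)^`N(j).[y%:C%:P] * (- 'X) ^+ j =
  \poly_(j < size Q) ((-1) ^+ j * Q^`N(j).[y%:C]).
  rewrite poly_def; apply: eq_bigr => j _.
  rewrite (nderivn_map polyC) horner_map.
  rewrite [(- 'X) ^+ j]exprNn [LHS]mul_polyC [(-1) ^+ j * _ in RHS]mulrC.
  rewrite -signr_odd -[in RHS]signr_odd; case: odd; rewrite ?expr1 ?expr0 ?mul1r ?mulr1//.
  by rewrite mulN1r mulrN1 scalerN scaleNr.
rewrite coef_poly ltn_ord.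
rewrite (@horner_coef_wide _ m); last first.
  by rewrite (leq_trans (size_poly _ _))// leq_subr.
rewrite mulr_sumr; apply: eq_bigr => k _.
by rewrite coef_nderivn mxE mulrA.
Qed.

(** The matrix is triangular with respect to the antidiagonal: entries with i + k >= m vanish, and
    those with i + k = m - 1 are nonzero multiples of the leading coefficient of [Q]. Column m - 1 -
    i then kills coordinate i of a row of the kernel, once the earlier ones are 0. *)
Lemma taylor_mx_unit : Q != 0 -> taylor_mx \in unitmx.
Proof.
move=> Q0.
rewrite -row_free_unit -kermx_eq0; apply/rowV0P => v /sub_kermxP vM.
suff h (n : nat) (i : 'I_m) : i = n :> nat -> v 0 i = 0.
  by apply/rowP => i; rewrite mxE; exact: (h i).
elim/ltn_ind : n i => n IH i iE.
have := congr1 (fun w : 'rV_m => w 0 (rev_ord i)) vM.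
rewrite !mxE (bigD1 i)//= big1 ?addr0 => [|l li]; last first.
  rewrite mxE; have [ln|nl|ln] := ltngtP l n.
  - by rewrite (IH l)// mul0r.
  - rewrite nth_default ?mul0rn ?mulr0//=.
    by have := ltn_ord i; rewrite -/m; lia.
  - by case/eqP : li; apply: val_inj; rewrite /= ln iE.
rewrite [taylor_mx _ _]mxE/= => /eqP; rewrite mulf_eq0 => /orP[/eqP//|].
rewrite mulf_eq0 signr_eq0/= mulrn_eq0.
have -> : (i + (m - i.+1) = m.-1)%N by have := ltn_ord i; lia.
have -> : ('C(m.-1, i) == 0)%N = false.
  by apply/negbTE; rewrite -lt0n bin_gt0; have := ltn_ord i; lia.
by rewrite -lead_coefE lead_coef_eq0 (negbTE Q0).
Qed.

(* [combo c al] is the polynomial p with sum_j c_j psi(al_j / t) = p(ln t) / t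
   for t > 1, when psi(u) = u Q(ln u) on ]0, 1[. *)
Definition combo n (c : 'I_n -> R[i]) (al : 'I_n -> R) : {poly R[i]} :=
  \sum_j (c j * (al j)%:C) *: shifted (ln (al j)).

Lemma size_combo n (c : 'I_n -> R[i]) al : (size (combo c al) <= m)%N.
Proof.
apply: (leq_trans (size_sum _ _ _)); apply/bigmax_leqP => j _.
by rewrite (leq_trans (size_scale_leq _ _))// size_shifted.
Qed.

Lemma coef_combo n (c : 'I_n -> R[i]) al (i : 'I_m) : (combo c al)`_i =
  \sum_(k < m) taylor_mx i k * \sum_(j < n) c j * (al j * ln (al j) ^+ k)%:C.
Proof.
rewrite coef_sum.
under [RHS]eq_bigr do rewrite mulr_sumr.
rewrite exchange_big/=; apply: eq_bigr => j _.
rewrite coefZ coef_shifted mulr_sumr; apply: eq_bigr => l _.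
by rewrite rmorphM rmorphXn/=; ring.
Qed.

Lemma horner_combo n (c : 'I_n -> R[i]) al (x : R) : (combo c al).[x%:C] =
  \sum_(j < n) c j * (al j)%:C * Q.[(ln (al j) - x)%:C].
Proof.
rewrite horner_sum; apply: eq_bigr => j _.
by rewrite hornerZ horner_comp !hornerE rmorphB.
Qed.

(** The inverse of [taylor_mx] recovers the moments from the tail polynomial, and [V] realises these
    moments at the nodes. [D] is the product of the two, so it depends on [Q] alone and the later
    estimates are uniform in the family. *)
Lemma moment_correction : Q != 0 -> exists D : 'M[R[i]]_m,
  forall n (c : 'I_n -> R[i]) (al : 'I_n -> R) (k : 'I_m),
  \sum_(j < m) (\sum_(i < m) D j i * (combo c al)`_i) *
      (node j * ln (node j) ^+ k)%:C =
  \sum_(j < n) c j * (al j * ln (al j) ^+ k)%:C.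
Proof.
move=> Q0; have [V hV] := node_moments m.
pose U := invmx taylor_mx.
exists (map_mx (real_complex R) V *m U) => n c al k.
pose mu : 'cV[R[i]]_m := \col_l \sum_(j < n) c j * (al j * ln (al j) ^+ l)%:C.
have pE : \col_i (combo c al)`_i = taylor_mx *m mu.
  apply/colP => i; rewrite !mxE coef_combo; apply: eq_bigr => l _.
  by rewrite [mu _ _]mxE.
have {}pE : U *m \col_i (combo c al)`_i = mu.
  by rewrite pE mulKmx// taylor_mx_unit.
transitivity (\sum_(j < m) (map_mx (real_complex R) V *m mu) j 0 *
    (node j * ln (node j) ^+ k)%:C).
  apply: eq_bigr => j _; congr (_ * _).
  by rewrite -pE mulmxA [RHS]mxE; apply: eq_bigr => i _; rewrite [X in _ = _ * X]mxE.
transitivity (\sum_(l < m) mu l 0 * (k == l)%:R).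
  under eq_bigr do rewrite [(_ *m _) _ _]mxE mulr_suml.
  rewrite exchange_big/=; apply: eq_bigr => l _.
  rewrite -[in RHS](rmorph_nat (real_complex R)) -hV rmorph_sum mulr_sumr.
  by apply: eq_bigr => j _; rewrite !rmorphM/= [map_mx _ _ _ _]mxE; ring.
rewrite (bigD1 k)//= eqxx mulr1 [mu _ _]mxE [X in _ + X]big1 ?addr0// => l lk.
by rewrite eq_sym (negbTE lk) mulr0.
Qed.

End moment_matrices.

(** * The substitution v = b / t *)

Section inverse_substitution.
Variable R : realType.
Local Notation mu := (@lebesgue_measure R).
Implicit Types (b x y t : R).

Lemma measurable_inv_pos : measurable_fun (`]0, +oo[ : set R) (@GRing.inv R).
Proof.
apply: (@eq_measurable_fun _ _ _ _ _ (fun x => x `^ (-1))).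
  by move=> x; rewrite inE/= in_itv/= andbT => x0; rewrite powR_inv1// ltW.
exact: measurable_funTS (measurable_powR _).
Qed.

Lemma measurable_div_pos b : measurable_fun (`]0, 1] : set R) (fun t => b / t).
Proof.
apply: measurable_funM; first exact: measurable_cst.
apply: measurable_funS measurable_inv_pos => //.
by move=> x /=; rewrite !in_itv/= => /andP[-> _].
Qed.

Lemma measurable_div_sqr b :
  measurable_fun (`]0, +oo[ : set R) (fun t => (b / t ^+ 2)%:E).
Proof.
apply/measurable_EFinP; apply: measurable_funM; first exact: measurable_cst.
rewrite [X in measurable_fun _ X](_ : _ = (fun t => t^-1 ^+ 2)).
  by apply: measurable_funX; exact: measurable_inv_pos.
by apply/funext => t; rewrite exprVn.
Qed.

Variables (b : R) (b0 : 0 < b).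

Definition inv_image (A : set R) : set R := `]0, 1] `&` (fun t => b / t) @^-1` A.

(** Made into a measure so that the change of variables reduces to the equality of two measures on
    [[b, +oo[]. *)
Definition inv_pushforward (A : set (measurableTypeR R)) : \bar R :=
  (\int[mu]_(t in inv_image A) (b / t ^+ 2)%:E)%E.

Lemma measurable_inv_image (A : set R) : measurable A -> measurable (inv_image A).
Proof. by move=> mA; apply: measurable_div_pos. Qed.

Let weight_ge0 t : (0 <= (b / t ^+ 2)%:E)%E.
Proof. by rewrite lee_fin divr_ge0 ?sqr_ge0// ltW. Qed.

Let inv_image_pos A : inv_image A `<=` `]0, +oo[.
Proof. by move=> x [] /=; rewrite !in_itv/= => /andP[->]. Qed.

Let mweight A : measurable A -> measurable_fun (inv_image A) (fun t => (b / t ^+ 2)%:E).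
Proof.
by move=> mA; apply: measurable_funS (measurable_div_sqr b).
Qed.

Let inv_pushforward0 : inv_pushforward set0 = 0%E.
Proof. by rewrite /inv_pushforward /inv_image preimage_set0 setI0 integral_set0. Qed.

Let inv_pushforward_ge0 A : (0 <= inv_pushforward A)%E.
Proof. exact: integral_ge0. Qed.

Let inv_pushforward_sigma_additive : semi_sigma_additive inv_pushforward.
Proof.
move=> F mF tF mUF; rewrite /inv_pushforward.
have E : inv_image (\bigcup_n F n) = \bigcup_n inv_image (F n).
  by rewrite /inv_image preimage_bigcup setI_bigcupr.
rewrite E ge0_integral_bigcup//.
- by apply: is_cvg_nneseries => n _ _; exact: integral_ge0.
- by move=> n; apply: measurable_inv_image; exact: mF.
- by rewrite -E; exact: mweight.
- move=> i j _ _ [x [[_ xi] [_ xj]]]; apply: tF => //.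
  by exists (b / x).
Qed.

HB.instance Definition _ := isMeasure.Build _ _ _ inv_pushforward
  inv_pushforward0 inv_pushforward_ge0 inv_pushforward_sigma_additive.

Lemma integral_div_sqr x y : 0 < x -> x <= y ->
  (\int[mu]_(t in `[x, y]) (b / t ^+ 2)%:E = (b / x - b / y)%:E)%E.
Proof.
move=> x0; rewrite le_eqVlt => /predU1P[<-|xy].
  by rewrite set_itv1 integral_set1 subrr.
have dF t : 0 < t -> is_derive t 1 (fun t => - (b / t)) (b / t ^+ 2).
  move=> t0; have t1 : t != 0 by rewrite gt_eqF.
  have h : is_derive t 1 (fun t => t^-1) (- t ^- 2).
    split; first exact: derivableV.
    by rewrite deriveV// derive_id scaler1.
  rewrite (_ : (fun t => _) = - (b \*: (@GRing.inv R))).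
    apply: is_derive_eq. by rewrite scalerN opprK.
  by apply/funext => u.
have cF t : 0 < t -> {for t, continuous (fun t => - (b / t))}.
  move=> /dF h; apply: differentiable_continuous; apply/derivable1_diffP.
  exact: ex_derive.
rewrite (@continuous_FTC2 _ _ (fun t => - (b / t)))//.
- by rewrite -EFinB opprK addrC.
- apply: continuous_in_subspaceT => t; rewrite inE/= in_itv/= => /andP[xt _].
  have t0 := lt_le_trans x0 xt.
  apply: cvgM; first exact: cvg_cst.
  by apply: cvgV; [rewrite expf_neq0// gt_eqF|exact: exprn_continuous].
- split.
  + move=> t; rewrite in_itv/= => /andP[xt _].
    by have := dF _ (lt_trans x0 xt) => h; exact: ex_derive.
  + by apply: cvg_at_right_filter; exact: cF.
  + by apply: cvg_at_left_filter; apply: cF; exact: lt_trans xy.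
- move=> t; rewrite in_itv/= => /andP[xt _].
  rewrite derive1E; have h := dF _ (lt_trans x0 xt); exact: derive_val.
Qed.

Let inv_pushforward_itv x y : b <= x -> x <= y ->
  inv_pushforward `]x, y] = (y - x)%:E.
Proof.
move=> bx xy; have x0 := lt_le_trans b0 bx; have y0 := lt_le_trans x0 xy.
(* The map t |-> b / t reverses the order, so the open end moves to the right; b <= x keeps the
   preimage inside ]0, 1]. *)
have -> : inv_pushforward `]x, y] = (\int[mu]_(t in `[(b / y)%R, (b / x)%R[) (b / t ^+ 2)%:E)%E.
  congr (integral _ _ _); apply/seteqP; split => t /=; rewrite /inv_image/=.
    move=> []; rewrite !in_itv/= => /andP[t0 t1] /andP[xt ty].
    by rewrite ler_pdivrMr// mulrC -ler_pdivrMr// ty/= ltr_pdivlMr// mulrC -ltr_pdivlMr.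
  rewrite !in_itv/= => /andP[yt tx].
  have t0 : 0 < t by rewrite (lt_le_trans _ yt)// divr_gt0.
  rewrite t0/=; split.
    by rewrite (le_trans (ltW tx))// ler_pdivrMr// mul1r.
  by rewrite ltr_pdivlMr// mulrC -ltr_pdivlMr// tx/= ler_pdivrMr// mulrC -ler_pdivrMr.
rewrite integral_itv_bndo_bndc; last first.
  apply: measurable_funS (measurable_div_sqr b) => //.
  move=> t /=; rewrite !in_itv/= andbT => /andP[yt _].
  by rewrite (lt_le_trans _ yt)// divr_gt0.
rewrite integral_div_sqr ?divr_gt0//.
  by congr EFin; field; rewrite !gt_eqF.
by rewrite ler_pM2l// lef_pV2.
Qed.

(* Lebesgue measure below [b] plus the pushforward of b t^-2 dt on ]0, 1] under
   t |-> b / t gives y - x to every ]x, y]. *)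
Lemma inv_pushforwardE (A : set R) : measurable A -> A `<=` `[b, +oo[ ->
  inv_pushforward A = mu A.
Proof.
move=> mA Ab; have mlt : measurable (`]-oo, b[ : set R) by [].
pose m := measure_add (mrestr mu mlt) inv_pushforward.
have mE0 X : m X = (mrestr mu mlt X + inv_pushforward X)%E := measure_addE _ _ X.
have -> : mu A = m A.
  apply: lebesgue_measure_unique => [X [[x y] _ <-]|//].
  rewrite -[RHS]/(m _) mE0 /mrestr /=.
  have [yx|xy] := leP y x.
    by rewrite set_itv_ge ?set0I ?measure0 ?adde0// -leNgt bnd_simp.
  have mE (u v : R) : u <= v -> mu `]u, v] = (v - u)%:E.
    rewrite lebesgue_measure_itv/= lte_fin le_eqVlt => /predU1P[->|->//].
    by rewrite ltxx subrr.
  have mE' (u v : R) : u <= v -> mu `]u, v[ = (v - u)%:E.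
    rewrite lebesgue_measure_itv/= lte_fin le_eqVlt => /predU1P[->|->//].
    by rewrite ltxx subrr.
  rewrite [LHS]mE ?ltW//.
  have [yb|by_] := ltP y b.
    rewrite (_ : `]x, y] `&` `]-oo, b[ = `]x, y]%classic); last first.
      apply/setIidPl => t /=; rewrite !in_itv/= => /andP[_ ty].
      exact: le_lt_trans yb.
    rewrite [X in (X + _)%E]mE ?ltW//.
    rewrite [X in (_ + X)%E](_ : _ = 0%E) ?adde0//.
    rewrite /inv_pushforward (_ : inv_image _ = set0) ?integral_set0//.
    rewrite -subset0 => t [/=]; rewrite !in_itv/= => /andP[t0 t1] /andP[_].
    apply/negP; rewrite -ltNge (lt_le_trans yb)// ler_pdivlMr//.
    by rewrite ler_piMr// ltW.
  have [bx|xb] := leP b x.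
    rewrite (_ : `]x, y] `&` `]-oo, b[ = set0); last first.
      rewrite -subset0 => t [/=]; rewrite !in_itv/= => /andP[xt _] tb.
      by have := lt_trans xt (lt_le_trans tb bx); rewrite ltxx.
    by rewrite measure0 add0e [RHS]inv_pushforward_itv// ltW.
  rewrite (_ : `]x, y] `&` `]-oo, b[ = `]x, b[%classic); last first.
    apply/seteqP; split => t /=; rewrite !in_itv/=.
      by move=> [/andP[-> _] ->].
    by move=> /andP[-> tb]; rewrite tb (le_trans (ltW tb)).
  rewrite [X in (X + _)%E]mE' ?ltW//.
  have y0 : 0 < y by exact: lt_le_trans by_.
  rewrite /inv_pushforward (_ : inv_image _ = `[b / y, 1]%classic).
    rewrite integral_div_sqr ?divr_gt0 ?ler_pdivrMr ?mul1r// -EFinD; congr EFin.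
    by field; rewrite !gt_eqF.
  apply/seteqP; split => t /=; rewrite /inv_image/=.
    move=> []; rewrite !in_itv/= => /andP[t0 ->] /andP[_].
    by rewrite ler_pdivrMr// mulrC -ler_pdivrMr// => ->.
  rewrite !in_itv/= => /andP[yt t1].
  have t0 : 0 < t by rewrite (lt_le_trans _ yt)// divr_gt0.
  rewrite t0 t1; split => //.
  have -> : b / t <= y by rewrite ler_pdivrMr// mulrC -ler_pdivrMr.
  by rewrite andbT (lt_le_trans xb)// ler_pdivlMr// ler_piMr// ltW.
rewrite mE0 /mrestr (_ : A `&` _ = set0) ?measure0 ?add0e//.
rewrite -subset0 => t [/Ab/=]; rewrite !in_itv/= andbT => bt tb.
by have := le_lt_trans bt tb; rewrite ltxx.
Qed.

Import HBNNSimple.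

Let inv_image_itv : inv_image `[b, +oo[ = `]0, 1]%classic.
Proof.
apply/seteqP; split => t; rewrite /inv_image/=; first by case.
rewrite !in_itv/= andbT => /andP[t0 t1]; rewrite t0 t1; split => //.
by rewrite ler_pdivlMr// ler_piMr// ltW.
Qed.

(** On each level set the identity is the definition of [inv_pushforward]; a simple function has
    finitely many of them. *)
Let integral_nnsfun_inv (f : {nnsfun (measurableTypeR R) >-> R}) :
  (\int[inv_pushforward]_(v in `[b, +oo[) (f v)%:E =
   \int[mu]_(t in `]0%R, 1%R]) ((f (b / t)%R)%:E * (b / t ^+ 2)%:E))%E.
Proof.
have mD : measurable (`[b, +oo[ : set (measurableTypeR R)) by [].
have mpre r : measurable (f @^-1` [set r]) by [].
have mw : measurable_fun (`]0, 1] : set R) (fun t : measurableTypeR R => (b / t ^+ 2)%:E).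
  by rewrite -inv_image_itv; exact: mweight.
have mi0 r : measurable_fun (`]0, 1] : set R)
    (fun t => \1_(f @^-1` [set r]) (b / t) : R).
  have m1 : measurable_fun setT (\1_(f @^-1` [set r]) : measurableTypeR R -> R).
    exact: measurable_indic.
  exact: (measurableT_comp m1 (measurable_div_pos b)).
have mi r : measurable_fun (`]0, 1] : set R)
    (fun t => (\1_(f @^-1` [set r]) (b / t))%:E : \bar R).
  by apply/measurable_EFinP; exact: mi0.
transitivity (\sum_(k \in range f)
    (\int[mu]_(t in `]0%R, 1%R]) ((k * \1_(f @^-1` [set k]) (b / t)%R)%:E * (b / t ^+ 2)%:E))%E)%E.
  under eq_integral do rewrite fimfunE -fsumEFin//.
  rewrite ge0_integral_fsum//; last 2 first.
  - by move=> y; exact/measurable_EFinP/measurable_funM.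
  - by move=> y x _; rewrite nnfun_muleindic_ge0.
  apply: eq_fsbigr => r; rewrite inE => -[x _ fx].
  have r0 : 0 <= r by rewrite -fx.
  rewrite integralZl_indic_nnsfun// integral_indic//=.
  under [RHS]eq_integral do rewrite EFinM -muleA.
  rewrite ge0_integralZl_EFin//; last 2 first.
  - by move=> t _; rewrite mule_ge0// lee_fin.
  - exact: (emeasurable_funM (mi r) mw).
  congr (_ * _)%E; rewrite /inv_pushforward.
  rewrite (_ : inv_image _ = `]0, 1] `&` (fun t => b / t) @^-1` (f @^-1` [set r])).
    rewrite integral_mkcondr; apply: eq_integral => t _.
    rewrite patchE indicE.
    have -> : (t \in (fun t => b / t) @^-1` (f @^-1` [set r])) = (b / t \in f @^-1` [set r]).
      by apply/idP/idP; rewrite !inE.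
    by case: ifP => _; rewrite ?mul1e ?mul0e.
  rewrite -inv_image_itv; apply/seteqP; split => t [] /=.
    by move=> t01 [fr bt].
  by move=> [t01 bt] fr.
rewrite -ge0_integral_fsum//.
- apply: eq_integral => t _; rewrite -ge0_mule_fsuml; last first.
    by move=> k; rewrite nnfun_muleindic_ge0.
  by rewrite fsumEFin// -fimfunE.
- move=> r.
  have mri : measurable_fun (`]0, 1] : set R)
      (fun t => ((r * \1_(f @^-1` [set r]) (b / t))%:E : \bar R)).
    by apply/measurable_EFinP; exact: (measurable_funM (measurable_cst r) (mi0 r)).
  exact: (emeasurable_funM mri mw).
- by move=> r t _; rewrite mule_ge0// nnfun_muleindic_ge0.
Qed.

(** On [[b, +oo[] the pushforward is Lebesgue measure, and monotone convergence passes from simple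
    functions to [G] on both sides. *)
Lemma ge0_integral_div_substitution (G : R -> \bar R) :
  measurable_fun `[b, +oo[ G -> (forall v, b <= v -> (0 <= G v)%E) ->
  (\int[mu]_(v in `[b, +oo[) G v =
   \int[mu]_(t in `]0%R, 1%R]) (G (b / t)%R * (b / t ^+ 2)%:E))%E.
Proof.
move=> mG G0.
have mD : measurable (`[b, +oo[ : set (measurableTypeR R)) by [].
have mw : measurable_fun (`]0, 1] : set R) (fun t : measurableTypeR R => (b / t ^+ 2)%:E).
  by rewrite -inv_image_itv; exact: mweight.
have bD t : `]0, 1]%classic t -> `[b, +oo[%classic (b / t).
  by rewrite -inv_image_itv => -[].
have G0' x : `[b, +oo[%classic x -> (0 <= G x)%E.
  by rewrite /= in_itv/= andbT; exact: G0.
transitivity (\int[inv_pushforward]_(v in `[b, +oo[) G v)%E.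
  apply: eq_measure_integral => A mA Ab; exact/esym/inv_pushforwardE.
pose f := nnsfun_approx mD mG.
have fG x : `[b, +oo[%classic x -> (f n x)%:E @[n --> \oo] --> G x.
  by move=> bx; apply: cvg_nnsfun_approx.
transitivity (limn (fun n => \int[inv_pushforward]_(x in `[b, +oo[) (f n x)%:E))%E.
  rewrite -monotone_convergence//.
  - by apply: eq_integral => y /[!inE] yD; apply/esym/cvg_lim => //; exact: fG.
  - by move=> n; exact/measurable_EFinP/measurable_funTS.
  - by move=> n y _; rewrite lee_fin.
  - by move=> y _ m n mn; rewrite lee_fin; exact/lefP/nd_nnsfun_approx.
under eq_fun do rewrite integral_nnsfun_inv.
rewrite -monotone_convergence//.
- apply: eq_integral => t /[!inE] tD; apply/cvg_lim => //.
  by apply: cvgeZr => //; exact/fG/bD.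
- move=> n; apply: emeasurable_funM => //; apply/measurable_EFinP.
  apply: (@measurableT_comp _ _ _ _ _ _ (f n) _ (fun t => b / t)) => //.
  exact: measurable_div_pos.
- by move=> n y _; rewrite mule_ge0// lee_fin.
- move=> t _ m n mn; rewrite lee_wpmul2r// lee_fin.
  by have /lefP := nd_nnsfun_approx mD mG mn; exact.
Qed.

End inverse_substitution.

(** * Coefficients of a polynomial and its mean square *)

Section log_polynomials.
Variable R : realType.
Local Notation mu := (@lebesgue_measure R).
Local Notation "t %:C" := (real_complex R t).
Implicit Types (p q W : {poly R}) (T x : R).

(** The primitive vanishing at 0: its constant coefficient is a division by 0, hence 0. Thus [(prim
    W).[T]] stands for the integral of W over [0, T] and can be computed on coefficients. *)
Definition prim W : {poly R} := \poly_(i < (size W).+1) (W`_i.-1 / i%:R).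

Lemma coef_prim W i : (prim W)`_i = W`_i.-1 / i%:R.
Proof.
rewrite coef_poly ltnS; case: leqP => // Wi.
by rewrite [in RHS]nth_default ?mul0r//; case: i Wi.
Qed.

Lemma deriv_prim W : (prim W)^`() = W.
Proof.
apply/polyP => i; rewrite coef_deriv coef_prim/= -[LHS]mulr_natr divfK//.
Qed.

Lemma primD p q : prim (p + q) = prim p + prim q.
Proof. by apply/polyP => i; rewrite !(coefD, coef_prim) mulrDl. Qed.

Lemma primZ (a : R) p : prim (a *: p) = a *: prim p.
Proof. by apply/polyP => i; rewrite !(coefZ, coef_prim) mulrA. Qed.

Lemma prim0 : prim 0 = 0.
Proof. by apply/polyP => i; rewrite !(coef0, coef_prim) mul0r. Qed.

Lemma primXn n : prim 'X^n = n.+1%:R^-1 *: 'X^(n.+1).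
Proof.
apply/polyP => -[|i]; rewrite coefZ coef_prim !coefXn /= ?invr0 ?mulr0// eqSS mulrC.
by have [->|] := eqVneq i n; rewrite ?mulr0.
Qed.

Lemma prim_sum (I : Type) (r : seq I) (F : I -> {poly R}) :
  prim (\sum_(i <- r) F i) = \sum_(i <- r) prim (F i).
Proof. exact: (big_morph prim primD prim0). Qed.

(** The function t |-> prim W (ln t) is an antiderivative of the integrand; this is the substitution
    x = ln t. *)
Lemma integral_horner_ln W T : 0 < T ->
  (\int[mu]_(t in `[1%R, expR T]) (W.[ln t] / t)%:E = ((prim W).[T])%:E)%E.
Proof.
move=> T0; have e1 : 1 < expR T by rewrite expR_gt1.
have pos (t : R) : 1 <= t -> 0 < t by exact: lt_le_trans.
pose F t := (prim W).[ln t].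
have dF (t : R) : 0 < t -> is_derive t 1 F (W.[ln t] / t).
  move=> t0; have hl := is_derive1_ln t0.
  have hp : is_derive (ln t) 1 (horner (prim W)) W.[ln t].
    split; first exact: derivable_horner.
    by rewrite -derive1E -derivE deriv_prim.
  have := @is_derive1_comp _ (horner (prim W)) (@ln R) t _ _ hp hl.
  exact.
have cF (t : R) : 0 < t -> {for t, continuous F}.
  move=> /dF h; apply: differentiable_continuous; apply/derivable1_diffP.
  exact: ex_derive.
rewrite (@continuous_FTC2 _ _ F)//.
- rewrite /F expRK ln1 horner_coef0 coef_prim invr0 mulr0.
  by rewrite sube0.
- apply: continuous_in_subspaceT => t; rewrite inE/= in_itv/= => /andP[/pos t0 _].
  apply: cvgM; last by apply: cvgV; [rewrite gt_eqF|exact: cvg_id].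
  apply: (@continuous_comp _ _ _ (@ln R) (horner W)).
    exact: continuous_ln.
  exact: continuous_horner.
- split.
  + move=> t; rewrite in_itv/= => /andP[/ltW/pos t0 _].
    by have h := dF _ t0; exact: ex_derive.
  + by apply: cvg_at_right_filter; exact: cF.
  + by apply: cvg_at_left_filter; apply: cF; exact: expR_gt0.
- move=> t; rewrite in_itv/= => /andP[/ltW/pos t0 _].
  by rewrite derive1E; have h := dF _ t0; exact: derive_val.
Qed.

Lemma prim_ge0 W T : 0 < T -> (forall x, 0 <= x <= T -> 0 <= W.[x]) ->
  0 <= (prim W).[T].
Proof.
move=> T0 W0; rewrite -lee_fin -integral_horner_ln//; apply: integral_ge0 => t /=.
rewrite in_itv/= => /andP[t1 tT]; have t0 : 0 < t by exact: lt_le_trans t1.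
rewrite lee_fin divr_ge0 ?(ltW t0)// W0// ln_ge0//=.
by rewrite -ler_expR lnK ?posrE.
Qed.

Lemma prim_le p q T : 0 < T -> (forall x, 0 <= x <= T -> p.[x] <= q.[x]) ->
  (prim p).[T] <= (prim q).[T].
Proof.
move=> T0 pq; rewrite -subr_ge0 -hornerN -hornerD.
have -> : prim q - prim p = prim (q - p) by rewrite -scaleN1r -primZ -primD scaleN1r.
by apply: prim_ge0 => // x xT; rewrite hornerD hornerN subr_ge0 pq.
Qed.

(** The choice l = sqrt T / N balances the two terms. This turns an integrated arithmetic-geometric
    inequality into the Cauchy-Schwarz one. *)
Lemma le_of_amgm (x C T N : R) : 0 < C -> 0 < T -> 0 <= N ->
  (forall l, 0 < l -> x <= C * ((l * N ^+ 2 + T / l) / 2)) ->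
  x <= C * (Num.sqrt T * N).
Proof.
move=> C0 T0; rewrite le_eqVlt => /predU1P[<- h|N0 h].
  (* When N = 0 no l is optimal; l = C T / x leads to x <= x / 2, which excludes x > 0. *)
  rewrite !mulr0 leNgt; apply/negP => x0.
  have := h (C * T / x); rewrite divr_gt0 ?mulr_gt0// => /(_ isT).
  rewrite expr0n/= mulr0 add0r.
  have -> : C * (T / (C * T / x) / 2) = x / 2.
    by field; rewrite !gt_eqF.
  by move=> xx; lra.
have s0 : 0 < Num.sqrt T by rewrite sqrtr_gt0.
have := h (Num.sqrt T / N); rewrite divr_gt0// => /(_ isT).
have -> : (Num.sqrt T / N * N ^+ 2 + T / (Num.sqrt T / N)) / 2 = Num.sqrt T * N.
  rewrite -{2}(sqr_sqrtr (ltW T0)).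
  by field; rewrite !gt_eqF.
by [].
Qed.

(** The k-th coefficient of p is the integral of p q over [0, T], where q is the dual polynomial of
    [dual_moments] rescaled from [0, 1], and |q| <= B T^-(k+1) there; Cauchy-Schwarz concludes. The
    majorant [D] of p^2 lets the same bound serve for real and imaginary parts. *)
Lemma real_coef_bound m : exists2 B, 0 < B &
  forall p D T N, (size p <= m)%N -> 0 < T -> 0 <= N ->
    (forall x, p.[x] ^+ 2 <= D.[x]) -> (prim D).[T] <= N ^+ 2 ->
    forall k, (k < m)%N -> `|p`_k| <= B * T^-1 ^+ k.+1 * (Num.sqrt T * N).
Proof.
have [G hG] := dual_moments R m.
pose B := 1 + \sum_k \sum_i `|G k i|.
have B0 : 0 < B by rewrite ltr_pwDl// sumr_ge0// => k _; rewrite sumr_ge0.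
exists B => // p D T N sp T0 N0 pD DN k km; pose k' := Ordinal km.
pose q : {poly R} := \sum_(i < m) (G k' i * T^-1 ^+ (i + k.+1)) *: 'X^i.
have pE : p = \sum_(j < m) p`_j *: 'X^j.
  by rewrite -poly_def; apply/polyP => i; rewrite coef_poly; case: ltnP => // ?;
    rewrite nth_default// (leq_trans sp).
have Jpq : (prim (p * q)).[T] = p`_k.
  rewrite {1}pE mulr_suml prim_sum horner_sum.
  transitivity (\sum_(j < m) p`_j * (T ^+ j * T^-1 ^+ k * (k' == j)%:R)); last first.
    rewrite (bigD1 k')//= eqxx mulr1 -exprMn divff ?gt_eqF// expr1n mulr1.
    rewrite [X in _ + X]big1 ?addr0// => j jk.
    by rewrite eq_sym (negbTE jk) !mulr0.
  apply: eq_bigr => j _.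
  rewrite -hG !mulr_sumr prim_sum horner_sum; apply: eq_bigr => i _.
  rewrite -scalerAl -scalerAr -exprD !primZ primXn !hornerZ hornerXn.
  congr (_ * _); rewrite exprVn exprVn [(j + i)%N]addnC -addnS !exprD !exprS.
  have : (i + j.+1)%:R != 0 :> R by rewrite pnatr_eq0 addnS.
  have Tn : T != 0 by rewrite gt_eqF.
  move: ((i + j.+1)%:R : R) => c c0.
  by field; rewrite ?c0 ?Tn ?expf_neq0.
have qB x : 0 <= x <= T -> `|q.[x]| <= B * T^-1 ^+ k.+1.
  move=> /andP[x0 xT]; rewrite horner_sum (le_trans (ler_norm_sum _ _ _))//.
  rewrite mulrDl mul1r ler_wpDl ?exprn_ge0 ?invr_ge0 ?(ltW T0)//.
  rewrite [in leRHS](bigD1 k')//= [leRHS]mulrDl ler_wpDr//.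
    rewrite mulr_ge0 ?exprn_ge0 ?invr_ge0 ?(ltW T0)// sumr_ge0// => l _.
    by rewrite sumr_ge0.
  rewrite mulr_suml; apply: ler_sum => i _.
  rewrite hornerZ hornerXn !normrM -mulrA ler_wpM2l// !ger0_norm ?exprn_ge0 ?invr_ge0 ?(ltW T0)//.
  rewrite exprD mulrAC -exprMn ler_piMl ?exprn_ge0 ?invr_ge0 ?(ltW T0)//.
  rewrite exprn_ile1// ?mulr_ge0 ?invr_ge0 ?(ltW T0)//.
  by rewrite mulrC ler_pdivrMr ?mul1r.
have C0 : 0 < B * T^-1 ^+ k.+1 by rewrite mulr_gt0// exprn_gt0// invr_gt0.
suff h (s : R) : `|s| = 1 -> s * p`_k <= B * T^-1 ^+ k.+1 * (Num.sqrt T * N).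
  have [pk|pk] := leP 0 p`_k.
    by rewrite ger0_norm// -[leLHS]mul1r h ?normr1.
  by rewrite ltr0_norm// -mulN1r h ?normrN1.
move=> s1; apply: le_of_amgm => // l l0.
rewrite -Jpq -hornerZ -primZ.
(* Pointwise majorant of |p q|, from 2 |p| <= l p^2 + 1 / l. *)
pose U : {poly R} := (B * T^-1 ^+ k.+1 / 2) *: (l *: D + l^-1 *: 'X^0).
have JU : (prim U).[T] = B * T^-1 ^+ k.+1 / 2 * (l * (prim D).[T] + l^-1 * T).
  by rewrite primZ hornerZ primD hornerD !primZ !hornerZ primXn hornerZ hornerXn invr1 mul1r.
apply: (@le_trans _ _ (prim U).[T]); last first.
  rewrite JU -!mulrA ler_pM2l// ler_pM2l ?exprn_gt0 ?invr_gt0// mulrC ler_pM2r//.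
  by rewrite lerD// ?ler_pM2l// mulrC.
apply: prim_le => // x xT.
rewrite !hornerZ hornerD !hornerZ hornerXn expr0 mulr1 hornerM.
rewrite (le_trans (ler_norm _))// !normrM s1 mul1r.
apply: (@le_trans _ _ (`|p.[x]| * (B * T^-1 ^+ k.+1))).
  by rewrite ler_wpM2l// qB.
rewrite [leLHS]mulrC -[B * _ / 2 * _]mulrA ler_pM2l// [leRHS]mulrC ler_pdivlMr//.
apply: (@le_trans _ _ (l * p.[x] ^+ 2 + l^-1)); last first.
  by rewrite lerD2r ler_pM2l.
rewrite -real_normK ?num_real// -subr_ge0.
have -> : l * `|p.[x]| ^+ 2 + l^-1 - `|p.[x]| * 2 = l^-1 * (l * `|p.[x]| - 1) ^+ 2.
  by field; rewrite gt_eqF.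
by rewrite mulr_ge0 ?sqr_ge0// invr_ge0 ltW.
Qed.

Lemma coef_bound m : exists2 B, 0 < B &
  forall (P : {poly R[i]}) T N, (size P <= m)%N -> 0 < T -> 0 <= N ->
    (\int[mu]_(t in `[1%R, expR T]) (cmod P.[(ln t)%:C] ^+ 2 / t)%:E <= (N ^+ 2)%:E)%E ->
    forall k, (k < m)%N -> cmod P`_k <= B * T^-1 ^+ k.+1 * (Num.sqrt T * N).
Proof.
have [B B0 hB] := real_coef_bound m.
exists (2 * B); first by rewrite mulr_gt0.
move=> P T N sP T0 N0 hP k km.
pose p := \poly_(i < m) complex.Re P`_i; pose q := \poly_(i < m) complex.Im P`_i.
have PE x : P.[x%:C] = Complex p.[x] q.[x].
  rewrite (horner_coef_wide _ sP) !horner_poly.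
  elim/big_ind3 : _ => //; first by move=> x1 x2 [? ?] y1 y2 [? ?] -> ->.
  move=> i _; case: (P`_i) => u v; rewrite -rmorphXn/=.
  by apply/eqP; rewrite eq_complex/= !mulr0 subr0 add0r !eqxx.
pose D := p ^+ 2 + q ^+ 2.
have DE x : D.[x] = cmod P.[x%:C] ^+ 2.
  by rewrite cmod_sqr PE/= hornerD !horner_exp.
have JD : (prim D).[T] <= N ^+ 2.
  rewrite -lee_fin -integral_horner_ln//.
  by under eq_integral do rewrite DE.
have h1 := hB p D T N (size_poly _ _) T0 N0 _ JD k km.
have h2 := hB q D T N (size_poly _ _) T0 N0 _ JD k km.
rewrite (le_trans (cmod_le_ReIm _))//.
have -> : 2 * B * T^-1 ^+ k.+1 * (Num.sqrt T * N) =
  B * T^-1 ^+ k.+1 * (Num.sqrt T * N) + B * T^-1 ^+ k.+1 * (Num.sqrt T * N) by ring.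
have -> : complex.Re P`_k = p`_k by rewrite coef_poly km.
have -> : complex.Im P`_k = q`_k by rewrite coef_poly km.
apply: lerD; [apply: h1|apply: h2] => x; rewrite hornerD !horner_exp.
  by rewrite lerDl sqr_ge0.
by rewrite lerDr sqr_ge0.
Qed.

End log_polynomials.

(** * Weighted quadratic norms *)

Section quadratic_norm.
Variable R : realType.
Local Notation mu := (@lebesgue_measure R).
Implicit Types (D E : set R) (h k : R -> R) (f g : R -> R[i]).

Definition rnorm D h : \bar R := ((\int[mu]_(t in D) (h t ^+ 2)%:E) `^ 2^-1)%E.

Lemma rnorm_ge0 D h : (0 <= rnorm D h)%E.
Proof. exact: poweR_ge0. Qed.

Lemma integral_sqr_ge0 D h : (0 <= \int[mu]_(t in D) (h t ^+ 2)%:E)%E.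
Proof. by apply: integral_ge0 => t _; rewrite lee_fin sqr_ge0. Qed.

Lemma rnorm_lty D h :
  (rnorm D h < +oo)%E <-> (\int[mu]_(t in D) (h t ^+ 2)%:E < +oo)%E.
Proof.
split; first by apply: lty_poweRy; rewrite invr_eq0 pnatr_eq0.
exact: poweR_lty.
Qed.

Lemma integral_rnorm D h N : 0 <= N -> rnorm D h = N%:E ->
  (\int[mu]_(t in D) (h t ^+ 2)%:E = (N ^+ 2)%:E)%E.
Proof.
move=> N0 hN; have := poweRrM (\int[mu]_(t in D) (h t ^+ 2)%:E)%E 2^-1 2.
rewrite -/(rnorm D h) hN poweR_EFin powR_mulrn// mulVf ?pnatr_eq0// poweRe1//.
exact: integral_sqr_ge0.
Qed.

Lemma measurable_sqr_EFin D h : measurable_fun D h ->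
  measurable_fun D (fun t => (h t ^+ 2)%:E : \bar R).
Proof. by move=> mh; apply/measurable_EFinP; exact: measurable_funX. Qed.

Lemma rnorm_le D E h k : measurable D -> measurable E -> D `<=` E ->
  measurable_fun D h -> measurable_fun E k ->
  (forall t, D t -> `|h t| <= k t) -> (rnorm D h <= rnorm E k)%E.
Proof.
move=> mD mE DE mh mk hk; apply: gt0_ler_poweR.
- by rewrite invr_ge0.
- by rewrite in_itv/= integral_sqr_ge0 leey.
- by rewrite in_itv/= integral_sqr_ge0 leey.
apply: (@le_trans _ _ (\int[mu]_(t in D) (k t ^+ 2)%:E)%E).
  apply: ge0_le_integral => //.
  - by move=> t _; rewrite lee_fin sqr_ge0.
  - exact: measurable_sqr_EFin.
  - by apply: measurable_sqr_EFin; exact: measurable_funS mk.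
  - move=> t Dt; rewrite lee_fin -(real_normK (num_real (h t))).
    by rewrite lerXn2r ?nnegrE ?hk// (le_trans _ (hk _ Dt)).
apply: ge0_subset_integral => //; first exact: measurable_sqr_EFin.
by move=> t _; rewrite lee_fin sqr_ge0.
Qed.

(** Extension by zero gives a Lebesgue norm on the whole line, where Minkowski's inequality is
    stated. *)
Lemma rnorm_Lnorm D h : rnorm D h = 'N[mu]_2%:E[EFin \o (h \_ D)]%E.
Proof.
rewrite unlock /rnorm [X in (X `^ _)%E = _]integral_mkcond; congr (_ `^ _)%E.
apply: eq_integral => t _ /=; rewrite /patch; case: ifP => _.
  by rewrite powR_mulrn// real_normK ?num_real.
(* Outside [D] the restriction takes the default value of [R]. *)
have -> : (point : R) = 0 by [].
by rewrite normr0 powR0// pnatr_eq0.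
Qed.

Lemma rnormD D h k : measurable D -> measurable_fun D h -> measurable_fun D k ->
  (rnorm D (fun t => h t + k t)%R <= rnorm D h + rnorm D k)%E.
Proof.
move=> mD mh mk; rewrite !rnorm_Lnorm.
have -> : (fun t => h t + k t) \_ D = ((h \_ D) \+ (k \_ D))%R.
  apply/funext => t; rewrite /patch/=; case: ifP => _ //.
  by have -> : (point : R) = 0 by []; rewrite addr0.
apply: minkowski_EFin; last by rewrite ler1n.
  exact: (iffLR (measurable_restrictT h mD) mh).
exact: (iffLR (measurable_restrictT k mD) mk).
Qed.

Lemma rnormZ D h a : measurable D -> measurable_fun D h -> 0 <= a ->
  rnorm D (fun t => a * h t) = (a%:E * rnorm D h)%E.
Proof.
move=> mD mh a0; rewrite /rnorm.
under eq_integral do rewrite exprMn EFinM.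
rewrite ge0_integralZl_EFin ?sqr_ge0//.
- rewrite poweRM ?integral_sqr_ge0 ?lee_fin ?sqr_ge0//; congr (_ * _)%E.
  by rewrite poweR_EFin powR12_sqrt ?sqr_ge0// sqrtr_sqr ger0_norm.
- by move=> t _; rewrite lee_fin sqr_ge0.
- exact: measurable_sqr_EFin.
Qed.

Lemma rnorm0 D : rnorm D (fun=> 0) = 0%E.
Proof.
rewrite /rnorm; under eq_integral do rewrite expr0n/=.
by rewrite integral0 poweR0r// invr_eq0 pnatr_eq0.
Qed.

Lemma rnorm_sum D (I : Type) (s : seq I) (F : I -> R -> R) : measurable D ->
  (forall i, measurable_fun D (F i)) ->
  (rnorm D (fun t => \sum_(i <- s) F i t)%R <= \sum_(i <- s) rnorm D (F i))%E.
Proof.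
move=> mD mF; elim: s => [|i s IH].
  rewrite big_nil (_ : (fun t => _) = (fun=> 0)) ?rnorm0//.
  by apply/funext => t; rewrite big_nil.
rewrite big_cons.
rewrite (_ : (fun t => _) = (fun t => F i t + \sum_(j <- s) F j t)); last first.
  by apply/funext => t; rewrite big_cons.
rewrite (le_trans (rnormD _ _ _))//; last by rewrite leeD2l.
exact: measurable_sum.
Qed.

(** Absorbing the square root of the weight turns [l2norm] into an unweighted norm of a real
    function. *)
Definition wabs (s : R) f (t : R) : R := cmod (f t) / Num.sqrt (t `^ (1 - 2 * s)).

Lemma wabs_ge0 s f t : 0 <= wabs s f t.
Proof. by rewrite divr_ge0 ?cmod_ge0 ?sqrtr_ge0. Qed.

Lemma wabs_sqr s f t : wabs s f t ^+ 2 = cmod (f t) ^+ 2 / t `^ (1 - 2 * s).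
Proof. by rewrite exprMn exprVn sqr_sqrtr// powR_ge0. Qed.

Lemma l2norm_rnorm s f : l2norm s f = rnorm `]0, +oo[ (wabs s f).
Proof.
by rewrite /l2norm /rnorm; under [in RHS]eq_integral do rewrite wabs_sqr.
Qed.

Lemma wabsD s f g t : wabs s (fun t => f t + g t) t <= wabs s f t + wabs s g t.
Proof. by rewrite -mulrDl ler_wpM2r ?invr_ge0 ?sqrtr_ge0// cmodD. Qed.

Lemma measurable_cmod D f : cmeasurable D f -> measurable_fun D (fun t => cmod (f t)).
Proof.
move=> [mr mi].
rewrite (_ : (fun t => _) = (fun t => (complex.Re (f t) ^+ 2 + complex.Im (f t) ^+ 2) `^ 2^-1)).
  apply: measurableT_comp (measurable_powR 2^-1) _.
  by apply: measurable_funD; exact: measurable_funX.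
apply/funext => t; rewrite -cmod_sqr powR12_sqrt ?sqr_ge0//.
by rewrite sqrtr_sqr ger0_norm ?cmod_ge0.
Qed.

Lemma measurable_wabs D s f : measurable D -> cmeasurable D f ->
  D `<=` `]0, +oo[ -> measurable_fun D (wabs s f).
Proof.
move=> mD mf D0; apply: measurable_funM; first exact: measurable_cmod.
apply: (@eq_measurable_fun _ _ _ _ _ (fun t => t `^ (- ((1 - 2 * s) * 2^-1)))).
  move=> t; rewrite inE => /D0; rewrite /= in_itv/= andbT => t0.
  by rewrite powRN powRrM powR12_sqrt ?powR_ge0.
exact: measurable_funTS (measurable_powR _).
Qed.

Lemma cmeasurableD D f g : cmeasurable D f -> cmeasurable D g ->
  cmeasurable D (fun t => f t + g t).
Proof.
move=> [fr fi] [gr gi]; split.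
  rewrite (_ : (fun t => _) = (fun t => complex.Re (f t) + complex.Re (g t))).
    exact: measurable_funD.
  by apply/funext => t; case: (f t); case: (g t).
rewrite (_ : (fun t => _) = (fun t => complex.Im (f t) + complex.Im (g t))).
  exact: measurable_funD.
by apply/funext => t; case: (f t); case: (g t).
Qed.

Lemma cmeasurableM D f g : cmeasurable D f -> cmeasurable D g ->
  cmeasurable D (fun t => f t * g t).
Proof.
move=> [fr fi] [gr gi]; split.
  rewrite (_ : (fun t => _) = (fun t => complex.Re (f t) * complex.Re (g t) -
    complex.Im (f t) * complex.Im (g t))).
    by apply: measurable_funB; exact: measurable_funM.
  by apply/funext => t; case: (f t); case: (g t).
rewrite (_ : (fun t => _) = (fun t => complex.Re (f t) * complex.Im (g t) +
    complex.Im (f t) * complex.Re (g t))).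
  by apply: measurable_funD; exact: measurable_funM.
by apply/funext => t; case: (f t); case: (g t).
Qed.

Lemma cmeasurable_cst D (c : R[i]) : cmeasurable D (fun=> c).
Proof. by split; exact: measurable_cst. Qed.

Lemma cmeasurableN D f : cmeasurable D f -> cmeasurable D (fun t => - f t).
Proof.
move=> /(cmeasurableM (cmeasurable_cst D (-1))).
by congr (cmeasurable _ _); apply/funext => t; rewrite mulN1r.
Qed.

Lemma cmeasurable_real D h : measurable_fun D h ->
  cmeasurable D (fun t => real_complex R (h t)).
Proof. by move=> mh; split => //; exact: measurable_cst. Qed.

Lemma cmeasurable_sum D (I : Type) (s : seq I) (F : I -> R -> R[i]) :
  (forall i, cmeasurable D (F i)) -> cmeasurable D (fun t => \sum_(i <- s) F i t).
Proof.
move=> mF; elim: s => [|i s IH].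
  rewrite (_ : (fun t => _) = (fun=> 0)); first exact: cmeasurable_cst.
  by apply/funext => t; rewrite big_nil.
rewrite (_ : (fun t => _) = (fun t => F i t + \sum_(j <- s) F j t)).
  exact: cmeasurableD.
by apply/funext => t; rewrite big_cons.
Qed.

Lemma cmeasurable_div D E f (a : R) : 0 < a -> measurable E -> measurable D ->
  E `<=` `]0, +oo[ -> (forall t, E t -> D (a / t)) ->
  cmeasurable D f -> cmeasurable E (fun t => f (a / t)).
Proof.
move=> a0 mE mD E0 ED [fr fi].
have md : measurable_fun E (fun t => a / t).
  apply: measurable_funM; first exact: measurable_cst.
  by apply: (measurable_funS _ E0 (@measurable_inv_pos R)).
split.
  apply: (measurable_comp mD _ fr md).
  by move=> _ [t Et <-]; exact: ED.
apply: (measurable_comp mD _ fi md).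
by move=> _ [t Et <-]; exact: ED.
Qed.

Lemma cmeasurable_subset D E f : measurable E -> D `<=` E ->
  cmeasurable E f -> cmeasurable D f.
Proof. move=> mE DE [fr fi]; split; [exact: (measurable_funS mE DE fr)|].
exact: (measurable_funS mE DE fi). Qed.

End quadratic_norm.

(** * Dilates of psi *)

Lemma measurable_powRV (R : realType) (D : set R) (s : R) :
  measurable_fun D (fun t => (t `^ s)^-1).
Proof.
rewrite (_ : (fun t => _) = (fun t => t `^ (- s))).
  exact: measurable_funTS (measurable_powR _).
by apply/funext => t; rewrite powRN.
Qed.

Section dilates.
Variable R : realType.
Local Notation mu := (@lebesgue_measure R).
Local Notation "t %:C" := (real_complex R t).

Variables (psi0 : R -> R[i]) (Q : {poly R[i]}).
Hypothesis psiQ : forall u, 0 < u -> u <= 1 -> psi0 u = u%:C * Q.[(ln u)%:C].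
Hypothesis mpsi : cmeasurable `]0, +oo[ psi0.

(* |f_A(t)| t^(sigma0 - 1/2) for A = (al, 1), whatever sigma0. *)
Definition dilate_abs (r al t : R) : R := t `^ (r - 2^-1) * cmod (psi0 (al / t)).

Lemma dilate_abs_ge0 r al t : 0 <= dilate_abs r al t.
Proof. by rewrite mulr_ge0 ?powR_ge0 ?cmod_ge0. Qed.

Lemma cmeasurable_dilate (D : set R) al : measurable D -> D `<=` `]0, +oo[ ->
  0 < al -> cmeasurable D (fun t => psi0 (al / t)).
Proof.
move=> mD D0 al0; apply: (cmeasurable_div al0 mD _ D0 _ mpsi) => // t /D0/=.
by rewrite !in_itv/= !andbT => t0; rewrite divr_gt0.
Qed.

Lemma measurable_dilate_abs (D : set R) r al : measurable D -> D `<=` `]0, +oo[ ->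
  0 < al -> measurable_fun D (dilate_abs r al).
Proof.
move=> mD D0 al0; apply: measurable_funM.
  exact: measurable_funTS (measurable_powR _).
by apply: measurable_cmod; exact: cmeasurable_dilate.
Qed.

Lemma dilate_abs_sqr r al t : 0 < t ->
  dilate_abs r al t ^+ 2 = t `^ (2 * r - 1) * cmod (psi0 (al / t)) ^+ 2.
Proof.
move=> t0; rewrite exprMn; congr (_ * _).
rewrite -powR_mulrn ?powR_ge0// -powRrM; congr (_ `^ _); by field.
Qed.

Lemma psi_bounded_near1 al : 0 < al -> exists2 M, 0 <= M &
  forall u, al <= u -> u <= 1 -> cmod (psi0 u) <= M.
Proof.
move=> al0; exists (\sum_(i < size Q) cmod Q`_i * `|ln al| ^+ i).
  by apply: sumr_ge0 => i _; rewrite mulr_ge0 ?cmod_ge0.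
move=> u alu u1; have u0 := lt_le_trans al0 alu.
rewrite psiQ// cmodM cmod_real (ger0_norm (ltW u0)).
rewrite -[leRHS]mul1r ler_pM ?cmod_ge0 ?(ltW u0)// horner_coef.
rewrite (le_trans (cmod_sum _ _ _))//; apply: ler_sum => i _.
rewrite cmodM cmodX cmod_real ler_wpM2l ?cmod_ge0// lerXn2r ?nnegrE//.
rewrite !ler0_norm ?ln_le0 ?(le_trans alu)// lerN2.
by rewrite ler_ln ?posrE.
Qed.

Variable r0 : R.
Hypothesis psi_int :
  (\int[mu]_(t in `[1%R, +oo[) (cmod (psi0 t) ^+ 2 / t `^ (1 + 2 * r0))%:E < +oo)%E.

(** On [al, 1] psi is bounded by its polynomial form; beyond 1 the weight only decreases when r0 is
    replaced by r. *)
Lemma weighted_psi_lty r al : r0 <= r -> 0 < al <= 1 ->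
  (\int[mu]_(v in `[al, +oo[) (cmod (psi0 v) ^+ 2 / v `^ (1 + 2 * r))%:E < +oo)%E.
Proof.
move=> r0r /andP[al0 al1].
have mw (D : set R) s : measurable D -> D `<=` `]0, +oo[ ->
    measurable_fun D (fun v => (cmod (psi0 v) ^+ 2 / v `^ (1 + 2 * s))%:E : \bar R).
  move=> mD D0; apply/measurable_EFinP; apply: measurable_funM.
    apply: measurable_funX; apply: measurable_cmod.
    exact: (cmeasurable_subset _ D0 mpsi).
  exact: measurable_powRV.
have ge0 s v : (0 <= (cmod (psi0 v) ^+ 2 / v `^ (1 + 2 * s))%:E)%E.
  by rewrite lee_fin divr_ge0 ?sqr_ge0 ?powR_ge0.
have D1 : `[al, 1] `<=` (`]0, +oo[ : set R).
  by move=> t /=; rewrite !in_itv/= andbT => /andP[h _]; exact: lt_le_trans h.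
have D2 : `]1, +oo[ `<=` (`]0, +oo[ : set R).
  by move=> t /=; rewrite !in_itv/= !andbT; exact: lt_trans.
have D3 : `[1, +oo[ `<=` (`]0, +oo[ : set R).
  by move=> t /=; rewrite !in_itv/= !andbT; exact: lt_le_trans.
have -> : `[al, +oo[%classic = `[al, 1] `|` `]1, +oo[ :> set R.
  by rewrite -itv_bndbnd_setU// bnd_simp.
rewrite ge0_integral_setU//; last 2 first.
- by apply: mw; [exact: measurableU|rewrite subUset].
- apply/disj_setPS => t [/=]; rewrite !in_itv/= andbT => /andP[_ t1] /(le_lt_trans t1).
  by rewrite ltxx.
apply: lte_add_pinfty.
  have [M M0 hM] := psi_bounded_near1 al0.
  (* Bounds v^-(1 + 2 r) on [al, 1] whatever the sign of 1 + 2 r. *)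
  pose C := expR (`|1 + 2 * r| * `|ln al|).
  apply: (@le_lt_trans _ _ (\int[mu]_(v in `[al, 1%R]) (M ^+ 2 * C)%:E)%E).
    apply: ge0_le_integral => //; first exact: mw.
    move=> v /=; rewrite in_itv/= => /andP[alv v1]; have v0 := lt_le_trans al0 alv.
    rewrite lee_fin ler_pM ?sqr_ge0 ?invr_ge0 ?powR_ge0//.
      by rewrite lerXn2r ?nnegrE ?cmod_ge0// hM.
    rewrite -powRN /powR gt_eqF// ler_expR (le_trans (ler_norm _))// normrM normrN.
    rewrite ler_wpM2l// !ler0_norm ?ln_le0 ?(le_trans alv)// lerN2.
    by rewrite ler_ln ?posrE.
  rewrite integral_cst//= lebesgue_measure_itv/=.
  by case: ifP => _; rewrite ?mule0 ?ltry// -EFinB -EFinM ltry.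
apply: le_lt_trans psi_int.
apply: (@le_trans _ _ (\int[mu]_(t in `]1%R, +oo[) (cmod (psi0 t) ^+ 2 / t `^ (1 + 2 * r0))%:E)%E).
  apply: ge0_le_integral => //; [exact: mw|exact: mw|].
  move=> t /=; rewrite in_itv/= andbT => t1.
  rewrite lee_fin ler_wpM2l ?sqr_ge0// lef_pV2 ?posrE ?powR_gt0 ?(lt_trans _ t1)//.
  by rewrite ler_powR ?(ltW t1)// lerD2l ler_pM2l.
apply: ge0_subset_integral => //; first exact: mw.
by move=> t /=; rewrite !in_itv/= !andbT => /ltW.
Qed.

(** The substitution v = al / t in [weighted_psi_lty] gives this square norm up to the factor al^(2
    r). *)
Lemma dilate_abs_rnorm_lty r al : r0 <= r -> 0 < al <= 1 ->
  (rnorm `]0%R, 1%R] (dilate_abs r al) < +oo)%E.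
Proof.
move=> r0r al01; have /andP[al0 al1] := al01; apply/rnorm_lty.
have := weighted_psi_lty r0r al01.
rewrite (ge0_integral_div_substitution al0); last 2 first.
- apply/measurable_EFinP; apply: measurable_funM.
    apply: measurable_funX; apply: measurable_cmod.
    apply: (cmeasurable_subset _ _ mpsi) => // t /=; rewrite !in_itv/= !andbT.
    exact: lt_le_trans.
  exact: measurable_powRV.
- by move=> v _; rewrite lee_fin divr_ge0 ?sqr_ge0 ?powR_ge0.
move=> fin.
have E t : t \in (`]0, 1]%classic : set R) -> (dilate_abs r al t ^+ 2)%:E =
    ((al `^ (2 * r))%:E * ((cmod (psi0 (al / t)) ^+ 2 / (al / t) `^ (1 + 2 * r))%:E *
      (al / t ^+ 2)%:E))%E.
  rewrite inE/= in_itv/= => /andP[t0 _].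
  rewrite dilate_abs_sqr// -!EFinM; congr EFin.
  have tV : t^-1 `^ (1 + 2 * r) = (t `^ (1 + 2 * r))^-1.
    by rewrite -powR_inv1 ?(ltW t0)// -powRrM mulN1r powRN.
  rewrite powRM ?invr_ge0 ?(ltW t0) ?(ltW al0)// tV.
  have -> : t `^ (1 + 2 * r) = t `^ (2 * r - 1) * t ^+ 2.
    rewrite -(powR_mulrn 2 (ltW t0)) -powRD ?(gt_eqF t0) ?implybT//.
    by congr (_ `^ _); ring.
  rewrite [al `^ (1 + _)]powRD ?(gt_eqF al0) ?implybT// powRr1 ?(ltW al0)//.
  have := powR_gt0 (2 * r) al0; have := powR_gt0 (2 * r - 1) t0.
  move: (t `^ _) (al `^ _) (cmod _) => X Y Z X0 Y0.
  by field; rewrite !gt_eqF.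
have mt : measurable_fun (`]0, 1] : set R)
  (fun t => (dilate_abs r al t ^+ 2)%:E : \bar R).
  apply: measurable_sqr_EFin; apply: measurable_dilate_abs => //.
  by move=> t /=; rewrite !in_itv/= andbT => /andP[].
under eq_integral => t tD do rewrite (E t tD).
rewrite ge0_integralZl_EFin ?powR_ge0//.
- by rewrite lte_mul_pinfty ?lee_fin ?powR_ge0.
- by move=> t _; rewrite mule_ge0 ?lee_fin ?divr_ge0 ?sqr_ge0 ?powR_ge0 ?(ltW al0).
- have al2 : al `^ (2 * r) != 0 by rewrite gt_eqF// powR_gt0.
  apply: (@eq_measurable_fun _ _ _ _ _ (fun t =>
      ((al `^ (2 * r))^-1%:E * (dilate_abs r al t ^+ 2)%:E)%E)).
    by move=> t tD; rewrite E// -!EFinM mulKf.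
  apply: emeasurable_funM => //; exact: measurable_cst.
Qed.

(** For t <= 1 the factor t^(r - 1/2) decreases as r grows; theta inherits its monotonicity from
    this. *)
Lemma dilate_abs_rnorm_le r r' al : r <= r' -> 0 < al ->
  (rnorm `]0%R, 1%R] (dilate_abs r' al) <= rnorm `]0%R, 1%R] (dilate_abs r al))%E.
Proof.
move=> rr al0.
have D0 : `]0, 1] `<=` (`]0, +oo[ : set R).
  by move=> t /=; rewrite !in_itv/= andbT => /andP[].
apply: rnorm_le => //; try exact: measurable_dilate_abs.
move=> t /=; rewrite in_itv/= => /andP[t0 t1].
rewrite ger0_norm ?dilate_abs_ge0// ler_wpM2r ?cmod_ge0//.
by rewrite ger_powR ?t0// lerD2r.
Qed.

End dilates.

Lemma split_lshift m n (i : 'I_m) : fintype.split (lshift n i) = inl i.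
Proof. exact: (unsplitK (inl i)). Qed.

Lemma split_rshift m n (i : 'I_n) : fintype.split (rshift m i) = inr i.
Proof. exact: (unsplitK (inr i)). Qed.

(** * Correction of a family of dilates into an element of S^sharp *)

Section approximation.
Variable R : realType.
Local Notation mu := (@lebesgue_measure R).
Local Notation "t %:C" := (real_complex R t).
Implicit Types (s r t : R) (w : R -> R[i]).

Lemma subset_itv01_0y : `]0, 1] `<=` (`]0, +oo[ : set R).
Proof. by move=> t /=; rewrite !in_itv/= andbT => /andP[]. Qed.

Lemma ae_rnorm_0y (h : R -> R) : measurable_fun (`]0, +oo[ : set R) h ->
  {ae mu, forall t, 1 < t -> h t = 0} ->
  rnorm `]0, +oo[ h = rnorm `]0, 1] h.
Proof.
move=> mh h0; rewrite /rnorm; congr (_ `^ _)%E.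
have D2 : `]1, +oo[ `<=` (`]0, +oo[ : set R).
  by move=> t /=; rewrite !in_itv/= !andbT; exact: lt_trans.
have -> : `]0, +oo[%classic = `]0, 1] `|` `]1, +oo[ :> set R.
  by rewrite -itv_bndbnd_setU// bnd_simp.
rewrite ge0_integral_setU//; last 3 first.
- apply: measurable_sqr_EFin; apply: measurable_funS mh => //.
  by rewrite subUset; split => //; exact: subset_itv01_0y.
- by move=> t _; rewrite lee_fin sqr_ge0.
- apply/disj_setPS => t [/=]; rewrite !in_itv/= andbT => /andP[_ t1] /(le_lt_trans t1).
  by rewrite ltxx.
rewrite [X in (_ + X)%E](_ : _ = 0%E) ?adde0//.
rewrite (@ge0_ae_eq_integral _ _ _ mu `]1, +oo[ _ (cst 0%E)) ?integral_cst ?mul0e//.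
- by apply: measurable_sqr_EFin; exact: measurable_funS mh.
- by move=> t _; rewrite lee_fin sqr_ge0.
- apply: (@filterS _ _ (ae_filter_ringOfSetsType _)) h0 => t h0 /=; rewrite in_itv/= andbT => /h0 ->.
  by rewrite expr0n.
Qed.

Variables (psi0 : R -> R[i]) (Q : {poly R[i]}).
Hypothesis psiQ : forall u, 0 < u -> u <= 1 -> psi0 u = u%:C * Q.[(ln u)%:C].
Hypothesis mpsi : cmeasurable `]0, +oo[ psi0.
Let m := size Q.

Definition dilates n (c : 'I_n -> R[i]) (al : 'I_n -> R) t : R[i] :=
  \sum_(j < n) c j * psi0 (al j / t).

(** The function f_A for a bare, possibly empty family: the shape of every element of the linear
    span, not only of the generators. *)
Definition weighted_dilates s r n (c : 'I_n -> R[i]) (al : 'I_n -> R) t : R[i] :=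
  (t `^ (r - s))%:C * dilates c al t.

Lemma fAE s r (A : multiplet R) :
  fA psi0 s r A = weighted_dilates s r (@coef _ A) (@alpha _ A).
Proof. by []. Qed.

Lemma sqrt_weight s r t : 0 < t ->
  t `^ (r - s) / Num.sqrt (t `^ (1 - 2 * s)) = t `^ (r - 2^-1).
Proof.
move=> t0; rewrite -powR12_sqrt ?powR_ge0// -powRrM -powRN -powRD ?(gt_eqF t0) ?implybT//.
by congr (_ `^ _); field.
Qed.

Lemma wabs_weighted_dilates s r n (c : 'I_n -> R[i]) al t : 0 < t ->
  wabs s (weighted_dilates s r c al) t = t `^ (r - 2^-1) * cmod (dilates c al t).
Proof.
move=> t0; rewrite /wabs cmodM cmod_real ger0_norm ?powR_ge0//.
by rewrite mulrAC sqrt_weight.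
Qed.

Lemma dilates_tail n (c : 'I_n -> R[i]) al t : (forall j, 0 < al j <= 1) ->
  1 <= t -> dilates c al t = (combo Q c al).[(ln t)%:C] / t%:C.
Proof.
move=> hal t1; have t0 : 0 < t by exact: lt_le_trans t1.
rewrite horner_combo mulr_suml; apply: eq_bigr => j _.
have /andP[a0 a1] := hal j.
rewrite psiQ ?divr_gt0//; last by rewrite ler_pdivrMr// mul1r (le_trans a1).
rewrite ln_div ?posrE// rmorphM fmorphV/=; ring.
Qed.

Lemma cmeasurable_weighted_dilates (D : set R) s r n (c : 'I_n -> R[i]) al :
  measurable D -> D `<=` `]0, +oo[ -> (forall j, 0 < al j <= 1) ->
  cmeasurable D (weighted_dilates s r c al).
Proof.
move=> mD D0 hal; apply: cmeasurableM.
  by apply: cmeasurable_real; exact: measurable_funTS (measurable_powR _).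
apply: cmeasurable_sum => j; apply: cmeasurableM; first exact: cmeasurable_cst.
by apply: cmeasurable_dilate => //; have /andP[] := hal j.
Qed.

Lemma wabs_dilates_le s r n (c : 'I_n -> R[i]) al t : 0 < t ->
  wabs s (weighted_dilates s r c al) t <=
    \sum_(j < n) cmod (c j) * dilate_abs psi0 r (al j) t.
Proof.
move=> t0; rewrite wabs_weighted_dilates//.
apply: (@le_trans _ _ (t `^ (r - 2^-1) * \sum_(j < n) cmod (c j) * cmod (psi0 (al j / t)))).
  rewrite ler_wpM2l ?powR_ge0// (le_trans (cmod_sum _ _ _))//.
  by apply: ler_sum => j _; rewrite cmodM.
rewrite mulr_sumr; apply: ler_sum => j _.
by rewrite /dilate_abs mulrCA.
Qed.

Lemma rnorm_dilates_le r n (c : 'I_n -> R[i]) al : (forall j, 0 < al j <= 1) ->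
  (rnorm `]0%R, 1%R] (fun t => \sum_(j < n) cmod (c j) * dilate_abs psi0 r (al j) t)%R <=
   \sum_(j < n) (cmod (c j))%:E * rnorm `]0%R, 1%R] (dilate_abs psi0 r (al j)))%E.
Proof.
move=> hal.
have md j : measurable_fun (`]0, 1] : set R) (dilate_abs psi0 r (al j)).
  by have /andP[? _] := hal j; apply: measurable_dilate_abs => //; exact: subset_itv01_0y.
rewrite (le_trans (rnorm_sum _ _ _))//.
  by move=> j; apply: measurable_funM => //; exact: measurable_cst.
by apply: lee_sum => j _; rewrite rnormZ ?cmod_ge0.
Qed.

Lemma calS_sharp_tail s r A t : Q != 0 -> calS_sharp m A -> 1 <= t ->
  fA psi0 s r A t = 0.
Proof.
move=> Q0 [[_ hal] hA] t1; rewrite fAE /weighted_dilates dilates_tail//.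
suff -> : combo Q (@coef _ A) (@alpha _ A) = 0 by rewrite horner0 mul0r mulr0.
apply/polyP => i; rewrite coef0.
have [im|mi] := ltnP i m; last first.
  by rewrite nth_default// (leq_trans (size_combo _ _ _)).
rewrite (@coef_combo _ Q _ _ _ (Ordinal im)) big1// => k _.
by rewrite hA ?mulr0// -ltnS prednK// size_poly_gt0.
Qed.

(** Membership in [K_sharp] includes square integrability. Here f_A vanishes beyond 1, and on ]0, 1]
    it is a finite combination of dilates of finite norm. *)
Lemma calS_sharp_L2 s r A : Q != 0 -> calS_sharp m A ->
  (forall al, 0 < al <= 1 -> (rnorm `]0%R, 1%R] (dilate_abs psi0 r al) < +oo)%E) ->
  L2 s (fA psi0 s r A).
Proof.
move=> Q0 hA fin; have hal := hA.1.2.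
have mf : cmeasurable `]0, +oo[ (fA psi0 s r A).
  exact: cmeasurable_weighted_dilates.
split => //; rewrite l2norm_rnorm ae_rnorm_0y; last 2 first.
- exact: measurable_wabs.
- apply: nearW => t t1; rewrite /wabs (calS_sharp_tail s r Q0 hA (ltW t1)).
  by rewrite cmod0 mul0r.
apply: (@le_lt_trans _ _ (\sum_(j < ell A) (cmod (coef j))%:E *
    rnorm `]0%R, 1%R] (dilate_abs psi0 r (alpha j)))%E).
  apply: le_trans (rnorm_dilates_le _ _ hal).
  apply: rnorm_le => //.
  - apply: measurable_wabs => //; last exact: subset_itv01_0y.
    by apply: cmeasurable_subset mf => //; exact: subset_itv01_0y.
  - apply: measurable_sum => j; apply: measurable_funM; first exact: measurable_cst.
    by have /andP[? _] := hal j; apply: measurable_dilate_abs => //; exact: subset_itv01_0y.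
  - move=> t /=; rewrite in_itv/= => /andP[t0 _].
    by rewrite ger0_norm ?wabs_ge0// wabs_dilates_le.
apply: lte_sum_pinfty => j _.
by rewrite lte_mul_pinfty ?lee_fin ?cmod_ge0// fin.
Qed.

Lemma linear_span_dilates s r h :
  linear_span [set fA psi0 s r A | A in calS (R := R)] h ->
  exists n (c : 'I_n -> R[i]) (al : 'I_n -> R),
    (forall j, 0 < al j <= 1) /\ h = weighted_dilates s r c al.
Proof.
move=> [n [c [f [hf ->]]]].
(* The families are merged over the disjoint union of their index sets, each coefficient being
   multiplied by that of its generator. *)
have {hf} /choice[A hA] : forall i, exists A, calS A /\ fA psi0 s r A = f i.
  by move=> i; have [A ? ?] := hf i; exists A.
pose I := {i : 'I_n & 'I_(ell (A i))}.
pose c' (p : I) := c (tag p) * coef (tagged p).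
pose al' (p : I) := alpha (tagged p).
exists #|{: I}|, (fun k => c' (enum_val k)), (fun k => al' (enum_val k)); split.
  by move=> k; exact: (hA _).1.2.
apply/funext => t; rewrite /weighted_dilates /dilates.
rewrite -(big_enum_val (fun p : I => c' p * psi0 (al' p / t))).
rewrite -(sig_big_dep predT (fun _ => predT) (fun i (j : 'I_(ell (A i))) =>
  c i * coef j * psi0 (alpha j / t)))/=.
rewrite mulr_sumr; apply: eq_bigr => i _.
rewrite -(hA i).2 /fA !mulr_sumr; apply: eq_bigr => j _.
by ring.
Qed.

(** The first factor collects the powers (1 - r)^k left by the bound on the k-th tail coefficient,
    the second the norms of the correcting dilates; the added 1 keeps the latter positive. *)
Definition node_weight r : R := (\sum_(k < m) (1 - r) ^+ k) *
  (1 + \sum_(j < m) fine (rnorm `]0%R, 1%R] (dilate_abs psi0 r (node R j)))).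

(* Averaging over 1 <= t <= exp (1 / (1 - r)) loses only a constant factor,
   since t^(r - 1) >= 1/e there. *)
Lemma tail_integral_le s r w n (c : 'I_n -> R[i]) al N : r < 1 ->
  (forall j, 0 < al j <= 1) -> L2star s w -> 0 <= N ->
  l2norm s (fun t => w t - weighted_dilates s r c al t) = N%:E ->
  (\int[mu]_(t in `[1%R, expR (1 - r)^-1])
    (cmod (combo Q c al).[(ln t)%:C] ^+ 2 / t)%:E <= ((expR 1 * N) ^+ 2)%:E)%E.
Proof.
move=> r1 hal [[mw _] w0] N0 hN.
pose F := weighted_dilates s r c al.
pose g t := w t - F t.
have mF : cmeasurable `]0, +oo[ F by exact: cmeasurable_weighted_dilates.
have mg : cmeasurable `]0, +oo[ g by apply: cmeasurableD => //; exact: cmeasurableN.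
have mgw : measurable_fun (`]0, +oo[ : set R) (wabs s g) by exact: measurable_wabs.
have mFw : measurable_fun (`]0, +oo[ : set R) (wabs s F) by exact: measurable_wabs.
have intg : (\int[mu]_(t in `]0%R, +oo[) (wabs s g t ^+ 2)%:E = (N ^+ 2)%:E)%E.
  by apply: integral_rnorm => //; rewrite -l2norm_rnorm.
pose T := (1 - r)^-1.
have T0 : 0 < T by rewrite invr_gt0 subr_gt0.
have D0 : `]1, expR T] `<=` (`]0, +oo[ : set R).
  by move=> t /=; rewrite !in_itv/= andbT => /andP[t1 _]; exact: lt_trans t1.
have D1 : `[1, expR T] `<=` (`]0, +oo[ : set R).
  by move=> t /=; rewrite !in_itv/= andbT => /andP[t1 _]; exact: lt_le_trans t1.
have pE t : 0 < t -> 1 <= t -> t <= expR T ->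
    cmod (combo Q c al).[(ln t)%:C] ^+ 2 / t <= expR 1 ^+ 2 * wabs s F t ^+ 2.
  move=> t0 t1 tT.
  rewrite wabs_weighted_dilates// (dilates_tail _ hal t1) cmodM cmodV cmod_real.
  rewrite (ger0_norm (ltW t0)) -exprMn -[X in _ / X](sqr_sqrtr (ltW t0)) -exprVn -exprMn.
  rewrite lerXn2r ?nnegrE ?mulr_ge0 ?cmod_ge0 ?invr_ge0 ?sqrtr_ge0 ?expR_ge0 ?powR_ge0 ?(ltW t0)//.
  rewrite mulrA [leRHS]mulrC -mulrA ler_wpM2l ?cmod_ge0//.
  rewrite -powR12_sqrt ?(ltW t0)// -powRN.
  have -> : t `^ (- 2^-1) = t `^ (1 - r) * (t^-1 * t `^ (r - 2^-1)).
    rewrite -(powR_inv1 (ltW t0)) -!powRD ?(gt_eqF t0) ?implybT//.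
    by congr (_ `^ _); field.
  rewrite mulrCA ler_wpM2l ?invr_ge0 ?(ltW t0)// ler_wpM2r ?powR_ge0//.
  rewrite /powR (gt_eqF t0) ler_expR -ler_pdivlMl ?subr_gt0// mulr1.
  by rewrite -ler_expR lnK ?posrE.
have mc : measurable_fun (`[1, expR T] : set R)
    (fun t => (expR 1 ^+ 2 * wabs s F t ^+ 2)%:E : \bar R).
  apply/measurable_EFinP; apply: measurable_funM; first exact: measurable_cst.
  by apply: measurable_funX; exact: measurable_funS mFw.
apply: (@le_trans _ _ (\int[mu]_(t in `[1%R, expR T])
    (expR 1 ^+ 2 * wabs s F t ^+ 2)%:E)%E).
  apply: ge0_le_integral => //.
  - move=> t /=; rewrite in_itv/= => /andP[t1 _].
    by rewrite lee_fin divr_ge0 ?sqr_ge0// (le_trans _ t1).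
  - apply/measurable_EFinP; apply: measurable_funM.
      apply: measurable_funX.
      apply: (@eq_measurable_fun _ _ _ _ _ (fun t => t * cmod (dilates c al t))).
        move=> t; rewrite inE/= in_itv/= => /andP[t1 _].
        rewrite (dilates_tail _ hal t1) cmodM cmodV cmod_real.
        have t0 : 0 < t by exact: lt_le_trans t1.
        by rewrite (ger0_norm (ltW t0)) mulrCA divff ?mulr1// gt_eqF.
      apply: measurable_funM => //; apply: measurable_cmod; apply: cmeasurable_sum => j.
      apply: cmeasurableM; first exact: cmeasurable_cst.
      by apply: cmeasurable_dilate => //; have /andP[] := hal j.
    by apply: measurable_funS (@measurable_inv_pos R).
  - move=> t /=; rewrite in_itv/= => /andP[t1 tT]; rewrite lee_fin pE//.
    exact: lt_le_trans t1.
(* The endpoint 1 is removed because [w] is known to vanish only for t > 1. *)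
rewrite -integral_itv_obnd_cbnd; last first.
  by apply: measurable_funS mc => // t /=; rewrite !in_itv/= => /andP[/ltW-> ->].
have -> : (\int[mu]_(t in `]1%R, expR T]) (expR 1 ^+ 2 * wabs s F t ^+ 2)%:E =
    \int[mu]_(t in `]1%R, expR T]) ((expR 1 ^+ 2)%:E * (wabs s g t ^+ 2)%:E))%E.
  apply: ge0_ae_eq_integral => //.
  - by apply: measurable_funS mc => // t /=; rewrite !in_itv/= => /andP[/ltW-> ->].
  - apply: emeasurable_funM; first exact: measurable_cst.
    by apply: measurable_sqr_EFin; exact: measurable_funS mgw.
  - by move=> t _; rewrite lee_fin mulr_ge0 ?sqr_ge0.
  - by move=> t _; rewrite mule_ge0// lee_fin sqr_ge0.
  - apply: (@filterS _ _ (ae_filter_ringOfSetsType _)) w0 => t w0 /=.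
    rewrite in_itv/= => /andP[/w0 wt _].
    by rewrite -EFinM /wabs /g wt add0r cmodN.
rewrite ge0_integralZl_EFin ?sqr_ge0//; last 2 first.
- by move=> t _; rewrite lee_fin sqr_ge0.
- by apply: measurable_sqr_EFin; exact: measurable_funS mgw.
rewrite exprMn [leRHS]EFinM lee_pmul2l ?lte_fin ?exprn_gt0 ?expR_gt0// -intg.
apply: ge0_subset_integral => //; first exact: measurable_sqr_EFin.
by move=> t _; rewrite lee_fin sqr_ge0.
Qed.

(* Subtracting from A the dilates at the nodes exp (- j) with the coefficients
   of [moment_correction] gives an element of S^sharp; these coefficients are
   linear in the tail of f_A, hence O(sqrt (1 - r)) by [coef_bound]. *)
Lemma sharp_correction : Q != 0 -> exists2 C, 0 < C &
  forall s r w n (c : 'I_n -> R[i]) al, r < 1 ->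
    (forall j, 0 < al j <= 1) -> L2star s w ->
    (forall a, 0 < a <= 1 -> (rnorm `]0%R, 1%R] (dilate_abs psi0 r a) < +oo)%E) ->
    exists2 A, calS_sharp m A &
      (l2norm s (fun t => (w t - fA psi0 s r A t)%R) <=
       (1 + C * node_weight r * Num.sqrt (1 - r))%:E *
       l2norm s (fun t => (w t - weighted_dilates s r c al t)%R))%E.
Proof.
move=> Q0; have [D hD] := moment_correction Q0.
have [B B0 hB] := coef_bound R m.
pose DD := \sum_j \sum_i cmod (D j i).
have DD0 : 0 <= DD.
  by apply: sumr_ge0 => j _; apply: sumr_ge0 => i _; exact: cmod_ge0.
(* [B] bounds coefficients by mean squares, [expR 1] is the loss in the averaging over the tail,
   [DD] the size of the correction matrix, and 1 secures positivity. *)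
exists (B * expR 1 * DD + 1); first by rewrite ltr_wpDl ?mulr_ge0 ?expR_ge0// ltW.
move=> s r w n c al r1 hal hw fin.
set C := _ + 1.
pose c' j := \sum_(i < m) D j i * (combo Q c al)`_i.
pose al' (j : 'I_(n + m)) := match fintype.split j with inl a => al a | inr b => node R b end.
pose co (j : 'I_(n + m)) := match fintype.split j with inl a => c a | inr b => - c' b end.
have hal' j : 0 < al' j <= 1.
  by rewrite /al'; case: fintype.split => a //; exact: node_itv.
pose A := Multiplet al' co.
have m0 : (0 < m)%N by rewrite size_poly_gt0.
have hA : calS_sharp m A.
  (* The m nodes make the family nonempty even when [n] is 0. *)
  split; first by split => //=; rewrite addn_gt0 m0 orbT.
  move=> k km; have km' : (k < m)%N by rewrite -(prednK m0) ltnS.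
  rewrite big_split_ord/=.
  under eq_bigr do rewrite /co /al' split_lshift.
  under [X in _ + X]eq_bigr do rewrite /co /al' split_rshift mulNr.
  rewrite sumrN -(hD _ _ _ (Ordinal km')) subrr//.
exists A => //.
have fAE' t : fA psi0 s r A t =
    weighted_dilates s r c al t - weighted_dilates s r c' (fun j : 'I_m => node R j) t.
  rewrite fAE /weighted_dilates -mulrBr /dilates big_split_ord/=; congr (_ * _).
  under eq_bigr do rewrite /co /al' split_lshift.
  under [X in _ + X = _]eq_bigr do rewrite /co /al' split_rshift mulNr.
  by rewrite sumrN.
have W0 : 0 <= node_weight r.
  rewrite mulr_ge0//; first by apply: sumr_ge0 => k _; rewrite exprn_ge0// subr_ge0 ltW.
  rewrite addr_ge0// sumr_ge0// => j _; rewrite fine_ge0//; exact: rnorm_ge0.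
have C0 : 0 < C by rewrite ltr_wpDl ?mulr_ge0 ?expR_ge0// ltW.
have K0 : 0 < 1 + C * node_weight r * Num.sqrt (1 - r).
  by rewrite ltr_pwDl// (mulr_ge0 (mulr_ge0 (ltW C0) W0))// sqrtr_ge0.
pose F := weighted_dilates s r c al.
pose g t := w t - F t.
have [hN|hN] := eqVneq (l2norm s g) +oo%E.
  by rewrite [X in (_ * X)%E]hN gt0_muley ?lte_fin// leey.
have NE : l2norm s g = (fine (l2norm s g))%:E.
  by rewrite fineK// ge0_fin_numE ?poweR_ge0// ltey.
set N := fine (l2norm s g) in NE.
have N0 : 0 <= N by rewrite fine_ge0// poweR_ge0.
have [[mw _] w0] := hw.
have mF : cmeasurable `]0, +oo[ F by exact: cmeasurable_weighted_dilates.
have mg : cmeasurable `]0, +oo[ g by apply: cmeasurableD => //; exact: cmeasurableN.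
have mfA : cmeasurable `]0, +oo[ (fA psi0 s r A) by exact: cmeasurable_weighted_dilates.
have mgA : cmeasurable `]0, +oo[ (fun t => w t - fA psi0 s r A t).
  by apply: cmeasurableD => //; exact: cmeasurableN.
pose d := 1 - r; have d0 : 0 < d by rewrite subr_gt0.
have hc' j : cmod (c' j) <= (\sum_(i < m) cmod (D j i) * d ^+ i) * (B * expR 1 * N * Num.sqrt d).
  rewrite (le_trans (cmod_sum _ _ _))// mulr_suml; apply: ler_sum => i _.
  rewrite cmodM -mulrA ler_wpM2l ?cmod_ge0//.
  have di0 : 0 < d^-1 by rewrite invr_gt0.
  have eN0 : 0 <= expR 1 * N by rewrite mulr_ge0// expR_ge0.
  have := hB (combo Q c al) d^-1 (expR 1 * N) (size_combo _ _ _) di0 eN0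
    (tail_integral_le r1 hal hw N0 NE) i (ltn_ord i).
  (* With T = 1 / d, the factor T^-(i+1) sqrt T is d^i sqrt d. *)
  move=> /le_trans; apply; rewrite invrK (sqrtrV (ltW d0)) exprS.
  rewrite le_eqVlt; apply/orP; left; apply/eqP.
  rewrite -{1}(sqr_sqrtr (ltW d0)); field.
  by rewrite gt_eqF// sqrtr_gt0.
rewrite l2norm_rnorm ae_rnorm_0y; last 2 first.
- exact: measurable_wabs.
- apply: (@filterS _ _ (ae_filter_ringOfSetsType _)) w0 => t w0 t1.
  by rewrite /wabs w0// (calS_sharp_tail s r Q0 hA (ltW t1)) subr0 cmod0 mul0r.
pose h t := \sum_(j < m) cmod (c' j) * dilate_abs psi0 r (node R j) t.
have mg1 : measurable_fun (`]0, 1] : set R) (wabs s g).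
  apply: measurable_wabs => //; last exact: subset_itv01_0y.
  by apply: cmeasurable_subset mg => //; exact: subset_itv01_0y.
have mh1 : measurable_fun (`]0, 1] : set R) h.
  apply: measurable_sum => j; apply: measurable_funM; first exact: measurable_cst.
  have /andP[? _] := node_itv R j.
  by apply: measurable_dilate_abs => //; exact: subset_itv01_0y.
apply: (@le_trans _ _ (rnorm `]0%R, 1%R] (fun t => wabs s g t + h t)%R)).
  apply: rnorm_le => //.
  - apply: measurable_wabs => //; last exact: subset_itv01_0y.
    by apply: cmeasurable_subset mgA => //; exact: subset_itv01_0y.
  - exact: measurable_funD.
  - move=> t /=; rewrite in_itv/= => /andP[t0 _].
    rewrite ger0_norm ?wabs_ge0//.
    have -> : wabs s (fun t => w t - fA psi0 s r A t) t =
        wabs s (fun t => g t + weighted_dilates s r c' (fun j : 'I_m => node R j) t) t.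
      by rewrite /wabs fAE' /g /F; congr (cmod _ / _); ring.
    by rewrite (le_trans (wabsD _ _ _ _))// lerD2l wabs_dilates_le.
rewrite (le_trans (rnormD _ _ _))//.
have gN : (rnorm `]0%R, 1%R] (wabs s g) <= N%:E)%E.
  rewrite -NE l2norm_rnorm; apply: rnorm_le => //.
  - exact: subset_itv01_0y.
  - exact: measurable_wabs.
  - by move=> t _; rewrite ger0_norm ?wabs_ge0.
rewrite NE -EFinM mulrDl mul1r EFinD leeD//.
rewrite (le_trans (rnorm_dilates_le _ _ _))//; first by move=> j; exact: node_itv.
pose G j := fine (rnorm `]0%R, 1%R] (dilate_abs psi0 r (node R j))).
have GE j : rnorm `]0%R, 1%R] (dilate_abs psi0 r (node R j)) = (G j)%:E.
  by rewrite fineK// ge0_fin_numE ?rnorm_ge0// fin// node_itv.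
have G0 j : 0 <= G j by rewrite fine_ge0// rnorm_ge0.
under eq_bigr do rewrite GE -EFinM.
rewrite sumEFin lee_fin.
pose S := \sum_(k < m) d ^+ k.
have S0 : 0 <= S by apply: sumr_ge0 => k _; rewrite exprn_ge0// ltW.
have X0 : 0 <= B * expR 1 * N * Num.sqrt d.
  by rewrite !mulr_ge0 ?sqrtr_ge0 ?expR_ge0// ltW.
apply: (@le_trans _ _ (\sum_(j < m) (DD * S * (B * expR 1 * N * Num.sqrt d)) * G j)).
  apply: ler_sum => j _; rewrite ler_wpM2r// (le_trans (hc' j))// ler_wpM2r//.
  rewrite mulr_sumr; apply: ler_sum => i _; rewrite ler_wpM2r ?exprn_ge0 ?(ltW d0)//.
  rewrite /DD (bigD1 j)//= (bigD1 i)//= -addrA lerDl addr_ge0// sumr_ge0// => k _.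
    exact: cmod_ge0.
  by apply: sumr_ge0 => l _; exact: cmod_ge0.
rewrite -mulr_sumr /node_weight -/d -/S.
have SG0 : 0 <= \sum_(j < m) G j by apply: sumr_ge0.
apply: (@le_trans _ _ ((C * Num.sqrt d * N * S) * (\sum_(j < m) G j))).
  rewrite ler_wpM2r// /C.
  have -> : (B * expR 1 * DD + 1) * Num.sqrt d * N * S =
    DD * S * (B * expR 1 * N * Num.sqrt d) + Num.sqrt d * N * S by ring.
  by rewrite lerDl !mulr_ge0 ?sqrtr_ge0.
have -> : C * (S * (1 + \sum_(j < m) fine (rnorm `]0%R, 1%R] (dilate_abs psi0 r (node R j))))) *
    Num.sqrt d * N = (C * Num.sqrt d * N * S) * (1 + \sum_(j < m) G j).
  by rewrite /G; ring.
by rewrite ler_wpM2l ?lerDr// !mulr_ge0 ?sqrtr_ge0// ltW.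
Qed.

End approximation.

(** * Distances *)

Section distances.
Variable R : realType.
Local Notation mu := (@lebesgue_measure R).
Local Notation "t %:C" := (real_complex R t).

Lemma l2normD s (f g : R -> R[i]) :
  cmeasurable `]0, +oo[ f -> cmeasurable `]0, +oo[ g ->
  (l2norm s (fun t => (f t + g t)%R) <= l2norm s f + l2norm s g)%E.
Proof.
move=> mf mg; rewrite !l2norm_rnorm.
have mwf : measurable_fun (`]0, +oo[ : set R) (wabs s f) by exact: measurable_wabs.
have mwg : measurable_fun (`]0, +oo[ : set R) (wabs s g) by exact: measurable_wabs.
apply: le_trans (rnormD _ mwf mwg) => //.
apply: rnorm_le => //.
- by apply: measurable_wabs => //; exact: cmeasurableD.
- exact: measurable_funD.
- by move=> t _; rewrite ger0_norm ?wabs_ge0// wabsD.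
Qed.

Lemma l2norm0 s : l2norm s (fun=> 0 : R[i]) = 0%E.
Proof.
rewrite l2norm_rnorm (_ : wabs _ _ = (fun=> 0)) ?rnorm0//.
by apply/funext => t; rewrite /wabs cmod0 mul0r.
Qed.

Lemma closed_span_subset s (E : set (R -> R[i])) f : E f -> L2 s f ->
  closed_span s E f.
Proof.
move=> Ef Lf; split => // e e0; exists f.
  exists 1%N, (fun=> 1), (fun=> f); split => //.
  by apply/funext => t; rewrite big_ord1 mul1r.
rewrite (_ : (fun t => _) = (fun=> 0)); first by rewrite l2norm0 lte_fin.
by apply/funext => t; rewrite subrr.
Qed.

(** An element of [K] is approximated within e / k by a finite family of dilates, to which
    [sharp_correction] applies; the factor k turns the error into e. The constant is fixed before s,
    r and w. *)
Lemma dist_sharp_le (psi0 : R -> R[i]) (Q : {poly R[i]}) :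
  (forall u, 0 < u -> u <= 1 -> psi0 u = u%:C * Q.[(ln u)%:C]) ->
  cmeasurable `]0, +oo[ psi0 -> Q != 0 ->
  exists2 C, 0 < C & forall s r w, r < 1 -> L2star s w ->
    (forall a, 0 < a <= 1 -> (rnorm `]0%R, 1%R] (dilate_abs psi0 r a) < +oo)%E) ->
    (dist s w (K_sharp psi0 s (size Q) r) <=
     (1 + C * node_weight psi0 Q r * Num.sqrt (1 - r))%:E * dist s w (K psi0 s r))%E.
Proof.
move=> psiQ mpsi Q0; have [C C0 hC] := sharp_correction psiQ mpsi Q0.
exists C => // s r w r1 hw fin; set k := 1 + _.
have k0 : 0 < k.
  rewrite ltr_pwDl// !mulr_ge0 ?sqrtr_ge0 ?(ltW C0)//.
    by apply: sumr_ge0 => i _; rewrite exprn_ge0// subr_ge0 ltW.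
  by rewrite addr_ge0// sumr_ge0// => j _; rewrite fine_ge0// rnorm_ge0.
suff h g : K psi0 s r g -> (dist s w (K_sharp psi0 s (size Q) r) <=
    k%:E * l2norm s (fun t => (w t - g t)%R))%E.
  rewrite -lee_pdivrMl//; apply: le_ereal_inf_tmp => _ [g Kg <-].
  by rewrite lee_pdivrMl// h.
move=> [[mg _] Kg]; apply/lee_addgt0Pr => e e0.
have [h /linear_span_dilates[n [c [al [hal hE]]]] gh] := Kg _ (divr_gt0 e0 k0).
have [A hA wA] := hC s r w n c al r1 hal hw fin.
have LA : L2 s (fA psi0 s r A) by apply: (calS_sharp_L2 (psi0 := psi0) (Q := Q)).
apply: (@le_trans _ _ (l2norm s (fun t => (w t - fA psi0 s r A t)%R))).
  apply: ereal_inf_lbound; exists (fA psi0 s r A) => //.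
  by apply: closed_span_subset => //; exists A.
apply: (le_trans wA); rewrite -hE.
have mh : cmeasurable `]0, +oo[ h.
  by rewrite hE; exact: cmeasurable_weighted_dilates.
have [[mw _] _] := hw.
apply: (@le_trans _ _ (k%:E * (l2norm s (fun t => (w t - g t)%R) +
    l2norm s (fun t => (g t - h t)%R)))%E).
  rewrite lee_pmul2l ?lte_fin//.
  rewrite (_ : (fun t => (w t - h t)%R) = (fun t => (w t - g t) + (g t - h t))).
    by apply: l2normD; apply: cmeasurableD => //; exact: cmeasurableN.
  by apply/funext => t; ring.
rewrite ge0_muleDr ?poweR_ge0// leeD2l// -lee_pdivlMl//.
by rewrite -EFinM mulrC; exact: ltW.
Qed.

End distances.

(** * Polynomial form and measurability of psi *)

Section psi_properties.
Variable R : realType.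
Local Notation "t %:C" := (real_complex R t).
Variables (a : nat -> R[i]) (L : R[i] -> R[i]) (phi : R -> R[i]) (sigma0 : R).

Lemma cmeasurable_eq (D : set R) (f g : R -> R[i]) :
  (forall t, D t -> f t = g t) -> cmeasurable D g -> cmeasurable D f.
Proof.
move=> fg [gr gi]; split; [apply: eq_measurable_fun gr|apply: eq_measurable_fun gi];
  by move=> t /[!inE] Dt; rewrite fg.
Qed.

Lemma cmeasurable_horner_ln (D : set R) (Q : {poly R[i]}) :
  measurable D -> cmeasurable D (fun u => u%:C * Q.[(ln u)%:C]).
Proof.
move=> mD; apply: cmeasurableM.
  by apply: cmeasurable_real; exact: measurable_id.
rewrite (_ : (fun u => _) = (fun u => \sum_(i < size Q) Q`_i * (ln u ^+ i)%:C)).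
  apply: cmeasurable_sum => i; apply: cmeasurableM; first exact: cmeasurable_cst.
  apply: cmeasurable_real; apply: measurable_funX.
  exact: measurable_funTS (@measurable_ln R).
by apply/funext => u; rewrite horner_coef; apply: eq_bigr => i _; rewrite rmorphXn.
Qed.

(** The range of summation depends on u. On ]0, N] it is replaced by a fixed range with indicators
    of u > n, and ]0, +oo[ is the union of these intervals. *)
Lemma cmeasurable_dirichlet_sum : cmeasurable `[0, +oo[ phi ->
  cmeasurable `]0, +oo[ (fun u =>
    \sum_(1 <= n < (Num.truncn u).+1 | n%:R < u) a n * phi (n%:R / u)).
Proof.
move=> mphi; set S := fun u : R => _.
have UE : `]0, +oo[%classic = \bigcup_N `]0, N%:R]%classic :> set R.
  apply/seteqP; split => [t /=|t [N _ /=]]; rewrite !in_itv/= ?andbT.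
    move=> t0; exists (Num.truncn t).+1 => //=.
    by rewrite in_itv/= t0/= ltW// truncnS_gt.
  by move=> /andP[].
suff h N : cmeasurable `]0, N%:R] S.
  by split; rewrite UE; apply/measurable_fun_bigcup => // N; [exact: (h N).1|exact: (h N).2].
have D0 : `]0, N%:R] `<=` (`]0, +oo[ : set R).
  by move=> t /=; rewrite !in_itv/= andbT => /andP[].
apply: (@cmeasurable_eq _ _ (fun u => \sum_(0 <= n < N)
    ((\1_(`]n.+1%:R, +oo[) u : R)%:C * a n.+1) * phi (n.+1%:R / u))).
  move=> u /=; rewrite in_itv/= => /andP[u0 uN].
  rewrite /S [LHS](@big_nat_widen _ _ _ 1 _ N.+1); last first.
    by rewrite ltnS -(@ler_nat R) (le_trans _ uN)// truncn_le// ltW.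
  rewrite big_mkcond big_add1/=; apply: eq_bigr => n _.
  rewrite indicE; case: ifPn => [/andP[nu _]|nu].
    by rewrite mem_set ?mul1r//= in_itv/= nu.
  rewrite memNset ?mul0r//= in_itv/= andbT => nu'; move: nu; rewrite nu'/=.
  by rewrite ltnS truncn_ge_nat ?(ltW u0)// (ltW nu').
apply: cmeasurable_sum => n; apply: cmeasurableM.
  apply: cmeasurableM; last exact: cmeasurable_cst.
  apply: cmeasurable_real; apply: measurable_funTS; exact: measurable_indic.
apply: (cmeasurable_div (D := `[0, +oo[)) => //.
move=> t /D0/=; rewrite !in_itv/= !andbT => t0.
by rewrite divr_ge0// ltW.
Qed.

Lemma psi_poly m : phi_hyp phi sigma0 -> (0 < m)%N ->
  has_pole (fun s => L s * mellin phi s) 1 m ->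
  exists Q : {poly R[i]}, [/\ size Q = m,
    forall u, 0 < u -> u <= 1 -> psi a L phi u = u%:C * Q.[(ln u)%:C] &
    cmeasurable `]0, +oo[ (psi a L phi)].
Proof.
move=> hphi m0 /residue_pole_cpow /(_ m0)[Q sQ hQ]; exists Q; split => //.
  move=> u u0 u1; rewrite /psi hQ// big_nat_cond big1 ?subr0// => n /andP[/andP[n1 _] nu].
  have : (1 : R) < 1 by rewrite (le_lt_trans _ (lt_le_trans nu u1))// ler1n.
  by rewrite ltxx.
apply: (@cmeasurable_eq _ _ (fun u => u%:C * Q.[(ln u)%:C] +
  - \sum_(1 <= n < (Num.truncn u).+1 | n%:R < u) a n * phi (n%:R / u))).
  by move=> u /=; rewrite in_itv/= andbT => u0; rewrite /psi hQ.
apply: cmeasurableD; first exact: cmeasurable_horner_ln.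
by apply: cmeasurableN; apply: cmeasurable_dirichlet_sum; exact: phi_measurable hphi.
Qed.

(** The points exp (-n) give as many common values as the size of the difference. Hence psi
    determines its polynomial, and with it m. *)
Lemma horner_ln_inj (P Q : {poly R[i]}) :
  (forall u, 0 < u -> u <= 1 -> u%:C * P.[(ln u)%:C] = u%:C * Q.[(ln u)%:C]) -> P = Q.
Proof.
move=> PQ; apply/eqP; rewrite -subr_eq0; apply/eqP.
apply: (@roots_geq_poly_eq0 _ _ [seq (- (n%:R : R))%:C | n <- iota 0 (size (P - Q)%R)]).
- apply/allP => _ /mapP[n _ ->]; rewrite rootE hornerD hornerN subr_eq0; apply/eqP.
  have /andP[n0 n1] := node_itv R n.
  have := PQ _ n0 n1; rewrite ln_node; apply: mulfI.
  by rewrite -cmod_eq0 cmod_real normr_eq0 gt_eqF.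
- rewrite map_inj_uniq ?iota_uniq// => i j /complexI/oppr_inj/eqP.
  by rewrite eqr_nat => /eqP.
- by rewrite size_map size_iota.
Qed.

End psi_properties.

(** * Positivity and monotonicity of the weight *)

Section node_weights.
Variables (R : realType) (psi0 : R -> R[i]) (Q : {poly R[i]}).
Hypothesis Q0 : Q != 0.

Lemma node_weight_gt0 r : r < 1 -> 0 < node_weight psi0 Q r.
Proof.
move=> r1; apply: mulr_gt0.
  have : (0 < size Q)%N by rewrite size_poly_gt0.
  case: (size Q) => // m _; rewrite big_ord_recl expr0 ltr_pwDl// sumr_ge0// => k _.
  by rewrite exprn_ge0// subr_ge0 ltW.
by rewrite ltr_pwDl// sumr_ge0// => j _; rewrite fine_ge0// rnorm_ge0.
Qed.

Lemma node_weight_le r r' : cmeasurable `]0, +oo[ psi0 ->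
  (forall a, 0 < a <= 1 -> (rnorm `]0%R, 1%R] (dilate_abs psi0 r a) < +oo)%E) ->
  r <= r' -> r' < 1 -> node_weight psi0 Q r' <= node_weight psi0 Q r.
Proof.
move=> mpsi fin rr r1; have d0 : 0 <= 1 - r' by rewrite subr_ge0 ltW.
have dd : 1 - r' <= 1 - r by rewrite lerD2l lerN2.
apply: ler_pM.
- by apply: sumr_ge0 => k _; rewrite exprn_ge0.
- by rewrite addr_ge0// sumr_ge0// => j _; rewrite fine_ge0// rnorm_ge0.
- by apply: ler_sum => k _; rewrite lerXn2r ?nnegrE// (le_trans d0).
rewrite lerD2l; apply: ler_sum => j _; have /andP[n0 n1] := node_itv R j.
have le := dilate_abs_rnorm_le mpsi rr n0.
have fr : (rnorm `]0%R, 1%R] (dilate_abs psi0 r (node R j)) < +oo)%E.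
  by apply: fin; rewrite n0.
apply: fine_le; last exact: le.
  by rewrite ge0_fin_numE; [exact: le_lt_trans fr|exact: rnorm_ge0].
by rewrite ge0_fin_numE; [exact: fr|exact: rnorm_ge0].
Qed.

End node_weights.

Theorem theorem4p1 (R : realType) :
  exists theta : (R -> R[i]) -> R -> R,
  forall (a : nat -> R[i]) (L : R[i] -> R[i]) (phi : R -> R[i])
    (sigma0 r0 : R) (m : nat),
    dirichlet_hyp a L sigma0 m ->
    phi_hyp phi sigma0 ->
    has_pole (fun s => L s * mellin phi s) 1 m ->
    sigma0 < r0 -> r0 < 1 ->
    (\int[lebesgue_measure]_(t in `[1%R, +oo[)
       (cmod (psi a L phi t) ^+ 2 / t `^ (1 + 2 * r0))%:E < +oo)%E ->
    let P := psi a L phi in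
    [/\ forall r : R, r0 <= r -> r < 1 -> 0 < theta P r,
        forall r r' : R, r0 <= r -> r <= r' -> r' < 1 -> theta P r' <= theta P r,
        forall (w : R -> R[i]) (r : R), L2star sigma0 w -> r0 <= r -> r < 1 ->
          (dist sigma0 w (K_sharp P sigma0 m r) <=
           (1 + theta P r * Num.sqrt (1 - r))%:E * dist sigma0 w (K P sigma0 r))%E
      & theta P r * Num.sqrt (1 - r) @[r --> (1:R)^'-] --> (0 : R)].
Proof.
pose represents (psi0 : R -> R[i]) (Q : {poly R[i]}) := [/\ Q != 0,
  forall u, 0 < u -> u <= 1 -> psi0 u = real_complex R u * Q.[real_complex R (ln u)] &
  cmeasurable `]0, +oo[ psi0].
(* The function is chosen from psi alone, before L, phi, sigma0 and m are introduced: a polynomial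
   representing psi is found from psi itself, and if there is none any function will do. *)
have /choice[theta htheta] : forall psi0, exists th : R -> R,
    forall Q, represents psi0 Q -> exists2 C, 0 < C &
      th = (fun r => C * node_weight psi0 Q r) /\
      forall s r w, r < 1 -> L2star s w ->
        (forall a, 0 < a <= 1 -> (rnorm `]0%R, 1%R] (dilate_abs psi0 r a) < +oo)%E) ->
        (dist s w (K_sharp psi0 s (size Q) r) <=
         (1 + th r * Num.sqrt (1 - r))%:E * dist s w (K psi0 s r))%E.
  move=> psi0; have [[Q hQ]|noQ] := pselect (exists Q, represents psi0 Q); last first.
    by exists (fun=> 0) => Q hQ; case: noQ; exists Q.
  have [Q0 psiQ mpsi] := hQ.
  have [C C0 hC] := dist_sharp_le psiQ mpsi Q0.
  exists (fun r => C * node_weight psi0 Q r) => Q' [_ psiQ' _]; exists C => //.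
  (* The estimate was proved for the [Q] picked for psi, and must hold for any representing
     polynomial. *)
  suff <- : Q = Q' by [].
  by apply: horner_ln_inj => u u0 u1; rewrite -psiQ// psiQ'.
exists theta => a L phi sigma0 r0 m hL hphi hpole sr r01 hint P.
have [Q [sQ psiQ mpsi]] := psi_poly a hphi (dirichlet_order hL) hpole.
have Q0 : Q != 0 by rewrite -size_poly_gt0 sQ; exact: dirichlet_order hL.
have [//|C C0 [thE hdist]] := htheta P Q.
have fin r : r0 <= r -> forall b, 0 < b <= 1 ->
    (rnorm `]0%R, 1%R] (dilate_abs P r b) < +oo)%E.
  by move=> r0r b b01; exact: (dilate_abs_rnorm_lty psiQ mpsi hint).
have th_gt0 r : r0 <= r -> r < 1 -> 0 < theta P r.
  by move=> _ r1; rewrite thE mulr_gt0// node_weight_gt0.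
have th_le r r' : r0 <= r -> r <= r' -> r' < 1 -> theta P r' <= theta P r.
  move=> r0r rr' r1; rewrite thE ler_pM2l//.
  by apply: node_weight_le => //; exact: fin.
split => //.
  move=> w r hw r0r r1; have := hdist sigma0 r w r1 hw (fin _ r0r).
  by rewrite sQ.
(* By monotonicity theta stays below its value at [r0], so the square root alone forces the
   limit. *)
apply: (@squeeze_cvgr _ _ _ _ (fun=> 0) (fun r => theta P r0 * Num.sqrt (1 - r))).
- near=> r.
  have r1 : r < 1 by near: r; exact: nbhs_left_lt.
  have r0r : r0 <= r by near: r; exact: nbhs_left_ge.
  rewrite mulr_ge0 ?sqrtr_ge0 ?(ltW (th_gt0 _ r0r r1))//=.
  by rewrite ler_wpM2r ?sqrtr_ge0// th_le.
- exact: cvg_cst.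
- rewrite -[X in _ --> X](mulr0 (theta P r0)); apply: cvgMl_tmp.
  rewrite -[X in _ --> X](@sqrtr0 R) -[X in Num.sqrt X](subrr 1).
  apply: cvg_at_left_filter.
  apply: (@continuous_comp _ _ _ (fun r : R => 1 - r) Num.sqrt).
    by apply: cvgB; [exact: cvg_cst|exact: cvg_id].
  exact: sqrt_continuous.
Unshelve. all: by end_near. Qed.
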